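(* Let $A$ be a Cohen-Macaulay local ring of dimension $d\ge1$ with infinite residue field and let $M$ be a maximal Cohen-Macaulay $A$-module. Let $I$ be an $\mathfrak m$-primary ideal of $A$ (where $\mathfrak m$ is the maximal ideal of $A$) with $r(I)\le 1$. Then for all $i\ge1$ and all $n\ge0$, $$\ell(\operatorname{Tor}_i^A(M,A/I^{n+1}))=\ell(\operatorname{Tor}_i^A(M,A/I))\binom{n+d-1}{d-1}.$$
   Context: Rings are Noetherian, modules finitely generated, $\ell$ denotes length. An ideal $J\subseteq I$ is a reduction of $I$ if there is $m$ with $JI^n=I^{n+1}$ for all $n\ge m$; the least such $m$ is $r_J(I)$. A reduction is minimal if it is minimal with respect to inclusion. The reduction number is $r(I)=\min\{r_J(I)\mid J \text{ a minimal reduction of } I\}$. *)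

(* Defs.v *)
From HB Require Import structures.
From mathcomp Require Import all_boot all_order all_algebra.
From mathcomp Require Import boolp classical_sets functions cardinality.

Set Implicit Arguments.
Unset Strict Implicit.
Unset Printing Implicit Defensive.

Import GRing.Theory.
Local Open Scope classical_set_scope.
Local Open Scope ring_scope.

Definition is_submodule (A : comNzRingType) (V : lmodType A) (W : V -> Prop) : Prop :=
  W 0 /\ forall (a : A) (u v : V), W u -> W v -> W (a *: u + v).

Record submodule (A : comNzRingType) (V : lmodType A) := Submodule {
  smcarrier :> V -> Prop;
  smP : is_submodule smcarrier }.

Definition ideal (A : comNzRingType) : Type := submodule A^o.

Section Submodules.
Context {A : comNzRingType} {V : lmodType A}.
Implicit Types (W : submodule V) (S : set V).

Lemma sm0 W : W 0. Proof. by case: (smP W). Qed.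

Lemma smZD W a u v : W u -> W v -> W (a *: u + v).
Proof. by case: (smP W) => _; apply. Qed.

Lemma smZ W a u : W u -> W (a *: u).
Proof. by move=> Wu; rewrite -[_ *: _]addr0; apply: smZD => //; exact: sm0. Qed.

Lemma smD W u v : W u -> W v -> W (u + v).
Proof. by move=> Wu Wv; rewrite -[u]scale1r; exact: smZD. Qed.

Lemma smB W u v : W u -> W v -> W (u - v).
Proof. by move=> Wu Wv; rewrite addrC -scaleN1r; apply: smZD. Qed.

Lemma sm_sum W n (f : 'I_n -> V) : (forall i, W (f i)) -> W (\sum_i f i).
Proof.
by move=> Wf; apply: (big_ind W) => [|u v|i _]; [exact: sm0|exact: smD|].
Qed.

Lemma submodule_smallest S : is_submodule (smallest (@is_submodule A V) S).
Proof.
split=> [W [[W0 _] _] //|a u v Su Sv W [WP SW]].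
by case: (WP) => _; apply; [apply: Su|apply: Sv].
Qed.

Definition span S : submodule V := Submodule (submodule_smallest S).

Lemma submodule_setT : is_submodule [set: V]. Proof. by []. Qed.

Definition topmod : submodule V := Submodule submodule_setT.

(* The carrier as a boolean predicate, the form under which MathComp builds
   subtypes and quotients. *)
Definition smpred W : {pred V} := fun v => `[< W v >].

Lemma smpredE W v : v \in smpred W <-> W v.
Proof. by split=> /asboolP. Qed.

Lemma smpred_submod_closed W : submod_closed (smpred W).
Proof.
split=> [|a u v /smpredE Wu /smpredE Wv]; first by apply/smpredE; exact: sm0.
by apply/smpredE; exact: smZD.
Qed.

HB.instance Definition _ W :=
  GRing.isSubmodClosed.Build A V (smpred W) (smpred_submod_closed W).

Definition submod_type W : Type := {v : V | v \in smpred W}.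

HB.instance Definition _ W := SubChoice.on (submod_type W).
HB.instance Definition _ W :=
  [SubChoice_isSubLmodule of submod_type W by <:].

Definition quot W : Type := Quotient.quot (smpred W).

HB.instance Definition _ W := GRing.Zmodule.on (quot W).

Section Quotient.
Variable W : submodule V.

Definition quot_pi (v : V) : quot W := \pi_(Quotient.quot (smpred W))%qT v.

Lemma quot_piP u v : quot_pi u = quot_pi v <-> W (u - v).
Proof.
rewrite /quot_pi; split=> [/eqP|Wuv].
  by rewrite -Quotient.idealrBE => /smpredE.
by apply/eqP; rewrite -Quotient.idealrBE; apply/smpredE.
Qed.

Lemma quot_pi_surj (q : quot W) : exists v, q = quot_pi v.
Proof. by exists (repr q); rewrite /quot_pi reprK. Qed.

Lemma quot_piD u v : quot_pi (u + v) = quot_pi u + quot_pi v.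
Proof. by rewrite /quot_pi !piE. Qed.

Definition quot_scale (a : A) (q : quot W) : quot W :=
  quot_pi (a *: repr q).

Lemma quot_scale_pi a v : quot_scale a (quot_pi v) = quot_pi (a *: v).
Proof.
apply/quot_piP; rewrite -scalerBr; apply: smZ.
by apply/quot_piP; rewrite /quot_pi reprK.
Qed.

Lemma quot_scaleA a b q :
  quot_scale a (quot_scale b q) = quot_scale (a * b) q.
Proof.
by case: (quot_pi_surj q) => v ->; rewrite !quot_scale_pi scalerA.
Qed.

Lemma quot_scale1 : left_id 1 quot_scale.
Proof.
by move=> q; case: (quot_pi_surj q) => v ->; rewrite quot_scale_pi scale1r.
Qed.

Lemma quot_scaleDr : right_distributive quot_scale +%R.
Proof.
move=> a p q; case: (quot_pi_surj p) => u ->; case: (quot_pi_surj q) => v ->.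
by rewrite -quot_piD !quot_scale_pi -quot_piD scalerDr.
Qed.

Lemma quot_scaleDl q : {morph quot_scale^~ q : a b / a + b}.
Proof.
move=> a b; case: (quot_pi_surj q) => v ->.
by rewrite !quot_scale_pi -quot_piD scalerDl.
Qed.

HB.instance Definition _ := GRing.Zmodule_isLmodule.Build A (quot W)
  quot_scaleA quot_scale1 quot_scaleDr quot_scaleDl.

End Quotient.

Lemma submodule_within (Z B : submodule V) :
  is_submodule (fun z : submod_type Z => B (val z)).
Proof.
split=> [|a u v Bu Bv]; first by rewrite raddf0; exact: sm0.
by rewrite linearP; exact: smZD.
Qed.

End Submodules.

(* $Z / (Z \cap B)$, that is $Z / B$ when $B \subseteq Z$. *)
Definition subquot (A : comNzRingType) (V : lmodType A) (Z B : submodule V)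
  : lmodType A :=
  quot (Submodule (submodule_within Z B)).

Section Chains.
Context {A : comNzRingType} {V : lmodType A}.

(* A chain with [n] strict inclusions, hence [n.+1] members. *)
Definition has_chain (P : submodule V -> Prop) (n : nat) : Prop :=
  exists c : nat -> submodule V,
    (forall i, (i <= n)%N -> P (c i)) /\
    (forall i, (i < n)%N -> c i `<` c i.+1).

(* The supremum of the lengths of the chains in [P] is finite, equal to [n]. *)
Definition chain_sup (P : submodule V -> Prop) (n : nat) : Prop :=
  has_chain P n /\ forall k, has_chain P k -> (k <= n)%N.

End Chains.

Definition has_length (A : comNzRingType) (V : lmodType A) (n : nat) : Prop :=
  chain_sup (fun _ : submodule V => True) n.

Section RingsAndModules.
Context {A : comNzRingType}.
Implicit Types (I J P Q m : ideal A) (M : lmodType A).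

Definition prime_ideal P : Prop :=
  ~ P 1 /\ forall x y : A, P (x * y) -> P x \/ P y.

Definition maximal_ideal m : Prop :=
  ~ m 1 /\ forall J, m `<=` J -> ~ J 1 -> J `<=` m.

(* [A] is local with maximal ideal [m]. *)
Definition local_ring m : Prop :=
  maximal_ideal m /\ forall m', maximal_ideal m' -> m' `<=>` m.

Definition finitely_generated (V : lmodType A) (W : V -> Prop) : Prop :=
  exists (n : nat) (s : 'I_n -> V),
    forall v, W v <-> exists a : 'I_n -> A, v = \sum_i a i *: s i.

Definition krull_dim (d : nat) : Prop := chain_sup prime_ideal d.

Definition annihilator M : set A := [set a | forall v : M, a *: v = 0].

Definition module_dim M (d : nat) : Prop :=
  chain_sup (fun P : ideal A => prime_ideal P /\ annihilator M `<=` P) d.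

Definition mulmod I (M : lmodType A) (N : submodule M) : submodule M :=
  span [set a *: v | a in (I : set A) & v in (N : set M)].

Fixpoint expid I (n : nat) : ideal A :=
  if n is k.+1 then mulmod I (expid I k) else topmod.

Definition radical I : set A := [set x | exists n, I (x ^+ n)].

Definition primary_ideal Q : Prop :=
  ~ Q 1 /\ forall x y : A, Q (x * y) -> Q x \/ exists n, Q (y ^+ n).

Definition primary_to m Q : Prop := primary_ideal Q /\ radical Q `<=>` m.

(* $(x_1, \dots, x_k) M$ *)
Definition seqmod M (x : seq A) : submodule M :=
  mulmod (span [set a : A^o | a \in x]) topmod.

(* Each $x_{k+1}$ is a nonzerodivisor on $M/(x_1,\dots,x_k)M$, and
   $(x_1,\dots,x_n)M \neq M$. *)
Definition regular_sequence M (x : seq A) : Prop :=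
  (forall k, (k < size x)%N ->
     forall v : M, seqmod M (take k x) (x`_k *: v) -> seqmod M (take k x) v) /\
  exists v : M, ~ seqmod M x v.

(* The supremum of the lengths of the [M]-regular sequences in [m]. *)
Definition has_depth m M (t : nat) : Prop :=
  (exists x : seq A,
     [/\ size x = t, forall a, a \in x -> m a & regular_sequence M x]) /\
  forall x : seq A,
    (forall a, a \in x -> m a) -> regular_sequence M x -> (size x <= t)%N.

(* For [A] local Noetherian with maximal ideal [m] and [M] finitely
   generated. The zero module is excluded: it has no regular sequence. *)
Definition cohen_macaulay m M : Prop :=
  exists t, has_depth m M t /\ module_dim M t.

Definition maximal_cohen_macaulay m M : Prop :=
  cohen_macaulay m M /\ exists t, module_dim M t /\ krull_dim t.

(* $J I^n = I^{n+1}$ for all $n \ge k$ *)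
Definition reduces_from I J (k : nat) : Prop :=
  forall n, (k <= n)%N -> mulmod J (expid I n) `<=>` expid I n.+1.

Definition reduction I J : Prop := J `<=` I /\ exists k, reduces_from I J k.

Definition minimal_reduction I J : Prop :=
  reduction I J /\ forall J', reduction I J' -> J' `<=` J -> J `<=` J'.

(* $r_J(I) = r$ *)
Definition reduction_number_wrt I J (r : nat) : Prop :=
  reduces_from I J r /\ forall s, reduces_from I J s -> (r <= s)%N.

(* $r(I) = r$ *)
Definition reduction_number I (r : nat) : Prop :=
  (exists J, minimal_reduction I J /\ reduction_number_wrt I J r) /\
  forall J s, minimal_reduction I J -> reduction_number_wrt I J s -> (r <= s)%N.

End RingsAndModules.

Arguments krull_dim A d : clear implicits.
Arguments seqmod {A} M x.

Definition noetherian (A : comNzRingType) : Prop :=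
  forall J : ideal A, finitely_generated J.

Section MatrixMap.
Context {A : comNzRingType} (N : lmodType A) (p q : nat) (D : 'M[A]_(p, q)).

(* $D \otimes N : A^p \otimes N = N^p \to N^q = A^q \otimes N$, where $A^p$ is
   the module of row vectors and $D$ acts on it by $x \mapsto xD$. *)
Definition mxmap (u : {ffun 'I_p -> N}) : {ffun 'I_q -> N} :=
  [ffun k => \sum_j D j k *: u j].

Lemma mxmapZD a u v : mxmap (a *: u + v) = a *: mxmap u + mxmap v.
Proof.
apply/ffunP => k; rewrite !ffunE scaler_sumr -big_split; apply: eq_bigr => j _.
by rewrite /= !ffunE scalerDr !scalerA mulrC.
Qed.

Lemma mxmap0 : mxmap 0 = 0.
Proof.
by apply/ffunP => k; rewrite !ffunE big1 // => j _; rewrite ffunE scaler0.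
Qed.

Lemma submodule_ker : is_submodule (fun u => mxmap u = 0).
Proof.
split=> [|a u v u0 v0]; first exact: mxmap0.
by rewrite mxmapZD u0 v0 scaler0 addr0.
Qed.

Lemma submodule_im : is_submodule (fun w => exists u, mxmap u = w).
Proof.
split=> [|a _ _ [u <-] [v <-]]; first by exists 0; exact: mxmap0.
by exists (a *: u + v); exact: mxmapZD.
Qed.

Definition mxker : submodule {ffun 'I_p -> N} := Submodule submodule_ker.
Definition mxim : submodule {ffun 'I_q -> N} := Submodule submodule_im.

End MatrixMap.

(* The data $\cdots \to A^{b_2} \to A^{b_1} \to A^{b_0} \to 0$. *)
Record free_complex (A : comNzRingType) := FreeComplex {
  fc_rank : nat -> nat;
  fc_diff : forall i, 'M[A]_(fc_rank i.+1, fc_rank i) }.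

Section Tor.
Context {A : comNzRingType}.
Implicit Types (F : free_complex A) (M N : lmodType A).

Definition cycles F N (i : nat) : submodule {ffun 'I_(fc_rank F i) -> N} :=
  match i with
  | 0 => topmod
  | j.+1 => mxker N (fc_diff F j)
  end.

Definition boundaries F N (i : nat) : submodule {ffun 'I_(fc_rank F i) -> N} :=
  mxim N (fc_diff F i).

(* $H_i(F \otimes_A N)$ *)
Definition homology F N (i : nat) : lmodType A :=
  subquot (cycles F N i) (boundaries F N i).

(* The augmentation $A^{b_0} \to M$ sends the [j]th basis vector to [e j]. *)
Definition free_resolution M F : Prop :=
  (forall i, cycles F A^o i.+1 `<=>` boundaries F A^o i.+1) /\
  exists e : 'I_(fc_rank F 0) -> M,
    (forall v, exists a : {ffun 'I_(fc_rank F 0) -> A^o},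
       v = \sum_j (a j : A) *: e j) /\
    (forall a : {ffun 'I_(fc_rank F 0) -> A^o},
       \sum_j (a j : A) *: e j = 0 <-> boundaries F A^o 0 a).

Definition zero_complex : free_complex A :=
  FreeComplex (fun i => 0 : 'M[A]_(0%N, 0%N)).

(* Some resolution of [M] by finite free modules: by [resolutionP] below one
   exists for every finitely generated [M] over a Noetherian ring. Outside that
   case the value is meaningless. *)
Definition resolution M : free_complex A :=
  if pselect (exists F, free_resolution M F) is left h
  then projT1 (cid h) else zero_complex.

Definition Tor (i : nat) M N : lmodType A := homology (resolution M) N i.

End Tor.

Section Existence.
Context {A : comNzRingType} (noethA : noetherian A).

Lemma noetherian_ffun n (K : submodule {ffun 'I_n -> A^o}) :
  finitely_generated K.
Proof.
elim: n K => [|n IHn] K.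
  exists 0%N, (fun=> 0) => v; split=> [_|_].
    by exists (fun=> 0); rewrite big_ord0; apply/ffunP; case.
  have -> : v = 0 by apply/ffunP; case.
  exact: sm0.
pose cons0 (u : {ffun 'I_n -> A^o}) : {ffun 'I_n.+1 -> A^o} :=
  [ffun i => if unlift ord0 i is Some j then u j else 0].
have cons0E (v : {ffun 'I_n.+1 -> A^o}) : v ord0 = 0 ->
    v = cons0 [ffun j => v (lift ord0 j)].
  move=> v0; apply/ffunP => i; rewrite !ffunE.
  by case: unliftP => [j ->|->]; rewrite ?ffunE.
have cons0Z a u : cons0 (a *: u) = a *: cons0 u.
  apply/ffunP => i; rewrite !ffunE; case: unlift => [j|]; rewrite ?ffunE //.
  by rewrite scaler0.
have cons0D u w : cons0 (u + w) = cons0 u + cons0 w.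
  apply/ffunP => i; rewrite !ffunE; case: unlift => [j|]; rewrite ?ffunE //.
  by rewrite addr0.
have cons00 : cons0 0 = 0.
  by rewrite -[0 in LHS](scale0r (0 : {ffun _ -> A^o})) cons0Z scale0r.
have J_sub : is_submodule (fun x : A^o => exists2 v, K v & v ord0 = x).
  split=> [|a _ _ [u Ku <-] [v Kv <-]].
    by exists 0; [exact: sm0|rewrite ffunE].
  by exists (a *: u + v); [exact: smZD|rewrite !ffunE].
have K'_sub : is_submodule (fun u => K (cons0 u)).
  split=> [|a u v Ku Kv]; first by rewrite cons00; exact: sm0.
  by rewrite cons0D cons0Z; exact: smZD.
have [p [x Jx]] := noethA (Submodule J_sub).
have [q [w K'w]] := IHn (Submodule K'_sub).
have /choice [t tP] i : exists v, K v /\ v ord0 = x i.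
  have [v Kv vx] : Submodule J_sub (x i); last by exists v.
  apply/Jx; exists (fun j => (j == i)%:R).
  rewrite (bigD1 i) //= eqxx scale1r big1 ?addr0 // => j /negPf ->.
  by rewrite scale0r.
have Kw i : K (cons0 (w i)).
  apply/(K'w (w i)); exists (fun j => (j == i)%:R).
  rewrite (bigD1 i) //= eqxx scale1r big1 ?addr0 // => j /negPf ->.
  by rewrite scale0r.
exists (p + q)%N, (fun i => match fintype.split i with
                            | inl j => t j | inr j => cons0 (w j) end) => v.
split=> [Kv|[a ->]]; last first.
  apply: sm_sum => i; apply: smZ; case: fintype.split => j; last exact: Kw.
  by case: (tP j).
have /Jx [a va] : Submodule J_sub (v ord0) by exists v.
pose v' := v - \sum_i a i *: t i.
have Kv' : K v'.
  by apply: smB => //; apply: sm_sum => i; apply: smZ; case: (tP i).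
have v'0 : v' ord0 = 0.
  rewrite !ffunE sum_ffunE va; apply/eqP; rewrite subr_eq0; apply/eqP.
  by apply: eq_bigr => i _; rewrite ffunE (tP i).2.
have : Submodule K'_sub [ffun j => v' (lift ord0 j)] by rewrite /= -cons0E.
move=> /K'w [b vb].
exists (fun i => match fintype.split i with inl j => a j | inr j => b j end).
rewrite big_split_ord /=.
rewrite (eq_bigr (fun i => a i *: t i)); last first.
  by move=> i _; rewrite (unsplitK (inl i)).
rewrite [X in _ + X](eq_bigr (fun i => b i *: cons0 (w i))); last first.
  by move=> i _; rewrite (unsplitK (inr i)).
have -> : \sum_i b i *: cons0 (w i) = v'.
  rewrite (cons0E v') // vb.
  rewrite (big_morph cons0 cons0D cons00).
  by apply: eq_bigr => i _; rewrite cons0Z.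
by rewrite addrC subrK.
Qed.

Lemma noetherian_mxim n (K : submodule {ffun 'I_n -> A^o}) :
  exists D : {p & 'M[A]_(p, n)}, mxim A^o (projT2 D) `<=>` K.
Proof.
have [p [s Ks]] := noetherian_ffun K.
exists (existT _ p (\matrix_(i, j) s i j)) => /=.
have rowsE a : mxmap (N := A^o) (\matrix_(i < p, j < n) s i j) a =
    \sum_i (a i : A) *: s i.
  apply/ffunP => k; rewrite !ffunE sum_ffunE; apply: eq_bigr => j _.
  by rewrite mxE ffunE; exact: mulrC.
split=> [_ [a <-]|v Kv]; first by rewrite rowsE; apply/Ks; exists a.
case/Ks: Kv => a ->; exists [ffun i => a i]; rewrite rowsE.
by apply: eq_bigr => i _; rewrite ffunE.
Qed.

Lemma free_resolution_exists (M : lmodType A) :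
  finitely_generated [set: M] -> exists F, free_resolution M F.
Proof.
move=> [n [e eP]].
have [gens gensP] : { gens : forall n, submodule {ffun 'I_n -> A^o} -> {p & 'M[A]_(p, n)}
    | forall n K, mxim A^o (projT2 (gens n K)) `<=>` K }.
  exists (fun n K => projT1 (cid (noetherian_mxim K))) => k K.
  exact: (projT2 (cid (noetherian_mxim K))).
pose step (T : {r & submodule {ffun 'I_r -> A^o}}) :
    {r & submodule {ffun 'I_r -> A^o}} :=
  let D := gens _ (projT2 T) in existT _ (projT1 D) (mxker A^o (projT2 D)).
have K0_sub : is_submodule
    (fun a : {ffun 'I_n -> A^o} => \sum_j (a j : A) *: e j = 0).
  split=> [|a u v u0 v0].
    by apply: big1 => j _; rewrite ffunE scale0r.
  rewrite (eq_bigr (fun j => a *: ((u j : A) *: e j) + (v j : A) *: e j)).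
    by rewrite big_split /= -scaler_sumr u0 v0 scaler0 addr0.
  by move=> j _; rewrite !ffunE scalerDl scalerA.
pose st i := iter i step (existT _ n (Submodule K0_sub)).
exists (@FreeComplex A (fun i => projT1 (st i))
  (fun i => projT2 (gens _ (projT2 (st i))))).
split=> [i|].
  have [H1 H2] := gensP _ (projT2 (st i.+1)).
  by split=> u /=; [exact: H2|exact: H1].
exists e; split=> [v|a].
  have /(eP v) [a ->] : [set: M] v by [].
  by exists [ffun j => a j]; apply: eq_bigr => j _; rewrite ffunE.
have [H1 H2] := gensP _ (projT2 (st 0%N)).
by split=> [a0|]; [exact: H2|exact: H1].
Qed.

Lemma resolutionP (M : lmodType A) :
  finitely_generated [set: M] -> free_resolution M (resolution M).
Proof.
move=> /free_resolution_exists exF; rewrite /resolution.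
by case: pselect => // h; exact: (projT2 (cid h)).
Qed.

End Existence.

(* Main.v *)
Require Import Defs.
From HB Require Import structures.
From mathcomp Require Import all_boot all_order all_algebra.
From mathcomp Require Import boolp classical_sets functions cardinality.
From mathcomp Require Import zify ring.

Set Implicit Arguments.
Unset Strict Implicit.
Unset Printing Implicit Defensive.

Import GRing.Theory.
Local Open Scope classical_set_scope.
Local Open Scope ring_scope.

Arguments smcarrier : simpl never.

(** Write [I ^ (n + 1) = J ^ n I] for a minimal reduction [J] with [J I = I ^ 2].
    The ideal [J] is generated by a sequence [xs] of length [d] that is regular
    both on [A] and on [M] ([minimal_reduction_regular]). Two consequences are
    used. First, the monomials [u] of degree [n] in [xs] are independent modulo
    [J]: if [\sum_u a_u u = 0], then all [a_u] lie in [J] ([quasi_regular]).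
    As [J] is contained in [I], these monomials, of which there are
    ['C(n + d - 1, d - 1)], give an embedding of that many copies of [A / I]
    into [A / I ^ (n + 1)] with cokernel [A / J ^ n]. Secondly,
    [Tor_i(M, A / J ^ n) = 0] for [i >= 1] ([tor_zero_gen], [tor_zero_mons]).
    By the long exact sequence, [Tor_i(M, A / I ^ (n + 1))] is a direct sum of
    copies of [Tor_i(M, A / I)], one for each monomial ([ilength_rcycles]).

    To find [xs], take a shortest system of generators of [J]. A homogeneous
    relation modulo [m] between its members has, the residue field being
    infinite, a point where it does not vanish; moving this point to a
    coordinate axis produces a reduction with fewer generators
    ([reduction_of_relation]). So the monomials in these generators are
    independent modulo [m], and the colength of [J ^ n] grows at least like
    [n ^ s], where [s] is the number of generators. It also grows at most like
    [n ^ d], since a regular sequence of length [d = dim A] generates an ideal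
    whose radical is [m] ([regseq_radical]). Hence [s <= d]
    ([size_indep_mons]). On the other side, regular sequences of length [d] on
    [A] and on [M] can be exchanged, one element at a time, for generic elements
    of [J] that are independent modulo [mJ] ([regular_elements_exist]). These
    [d] elements then generate [J].

    Everything takes place among the submodules of a fixed module, mostly a free
    one: the length of a subquotient [U / W] is that of the interval from [W] to
    [U], and [Tor_i(M, A / K)] is described by the vectors that are cycles, or
    boundaries, modulo [K]. *)

(** * Sums of submodules and combinations with prescribed coefficients *)

Section Calculus.
Context {A : comNzRingType}.

Lemma submodule_ext (V : lmodType A) (W X : submodule V) :
  (forall v, W v <-> X v) -> W = X.
Proof.
case: W X => [W Wp] [X Xp] /= WX.
have eWX : W = X by apply/funext => v; apply/propext.
by subst X; congr Submodule; exact: Prop_irrelevance.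
Qed.

Lemma submodule_eqE (V : lmodType A) (W X : submodule V) :
  W `<=>` X -> W = X.
Proof. by move=> [WX XW]; apply: submodule_ext => v; split; [exact: WX|exact: XW]. Qed.

Context {V : lmodType A}.
Implicit Types (W X K : submodule V) (us vs : seq A).

Lemma smN W v : W (- v) -> W v.
Proof. by move=> /(smZ (-1)); rewrite scaleN1r opprK. Qed.

Lemma smDl W u v : W u -> W (u + v) -> W v.
Proof. by move=> Wu Wuv; rewrite -[v](addKr u) addrC; apply: smB. Qed.

Lemma is_submodule_zero : is_submodule (fun v : V => v = 0).
Proof. by split=> // a u v -> ->; rewrite scaler0 addr0. Qed.
Definition zerom : submodule V := Submodule is_submodule_zero.

Lemma is_submodule_add W X :
  is_submodule (fun v => exists w x, [/\ W w, X x & v = w + x]).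
Proof.
split=> [|a _ _ [w [x [Ww Xx ->]]] [w' [x' [Ww' Xx' ->]]]].
  by exists 0, 0; split; [exact: sm0|exact: sm0|rewrite addr0].
exists (a *: w + w'), (a *: x + x'); split; [exact: smZD|exact: smZD|].
by rewrite scalerDr addrACA.
Qed.
Definition addm W X : submodule V := Submodule (is_submodule_add W X).

Lemma is_submodule_cap W X : is_submodule (fun v => W v /\ X v).
Proof.
by split=> [|a u v [Wu Xu] [Wv Xv]]; split; (exact: sm0 || exact: smZD).
Qed.
Definition capm W X : submodule V := Submodule (is_submodule_cap W X).

Lemma is_submodule_scal a K : is_submodule (fun v => exists2 k, K k & v = a *: k).
Proof.
split=> [|b _ _ [k Kk ->] [k' Kk' ->]].
  by exists 0; [exact: sm0|rewrite scaler0].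
exists (b *: k + k'); first exact: smZD.
by rewrite scalerDr !scalerA mulrC.
Qed.
Definition scal a K : submodule V := Submodule (is_submodule_scal a K).

Lemma is_submodule_div X a : is_submodule (fun v => X (a *: v)).
Proof.
split=> [|b u v Xu Xv]; first by rewrite scaler0; exact: sm0.
by rewrite scalerDr scalerA mulrC -scalerA; exact: smZD.
Qed.
Definition divm X a : submodule V := Submodule (is_submodule_div X a).

Lemma is_submodule_colon X v : is_submodule (fun a : A^o => X ((a : A) *: v)).
Proof.
split=> [|b a a' Xa Xa']; first by rewrite scale0r; exact: sm0.
by rewrite scalerDl -[b *: a]/(b * a) -scalerA; exact: smZD.
Qed.
Definition colon X v : ideal A := Submodule (is_submodule_colon X v).

Lemma is_submodule_line (v : V) : is_submodule (fun x => exists a : A, x = a *: v).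
Proof.
split=> [|a _ _ [b ->] [c ->]]; first by exists 0; rewrite scale0r.
by exists (a * b + c); rewrite scalerDl scalerA.
Qed.
Definition line v : submodule V := Submodule (is_submodule_line v).

Lemma line_mem v : line v v. Proof. by exists 1; rewrite scale1r. Qed.

Lemma divmE X a v : divm X a v = X (a *: v). Proof. by []. Qed.
Lemma colonE X v a : colon X v a = X (a *: v). Proof. by []. Qed.

Lemma addml W X v : W v -> addm W X v.
Proof. by move=> Wv; exists v, 0; split; [|exact: sm0|rewrite addr0]. Qed.

Lemma addmr W X v : X v -> addm W X v.
Proof. by move=> Xv; exists 0, v; split; [exact: sm0| |rewrite add0r]. Qed.

Lemma addm_min W X K : W `<=` K -> X `<=` K -> addm W X `<=` K.
Proof. by move=> WK XK _ [w [x [/WK Kw /XK Kx ->]]]; exact: smD. Qed.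

Lemma addmC W X : addm W X = addm X W.
Proof.
by apply: submodule_eqE; split; apply: addm_min => v ?;
   (exact: addmr || exact: addml).
Qed.

Lemma addmA W X K : addm W (addm X K) = addm (addm W X) K.
Proof.
apply: submodule_eqE; split; apply: addm_min.
- by move=> v Wv; do 2!apply: addml.
- by apply: addm_min => v ?; [apply/addml/addmr|apply: addmr].
- by apply: addm_min => v ?; [apply: addml|apply/addmr/addml].
- by move=> v Kv; do 2!apply: addmr.
Qed.

Lemma addmCA W X K : addm W (addm X K) = addm X (addm W K).
Proof. by rewrite !addmA (addmC W). Qed.

Fixpoint lc us K : submodule V :=
  if us is u :: us' then addm (scal u K) (lc us' K) else zerom.

Fixpoint comb us (f : nat -> V) : V :=
  if us is u :: us' then u *: f 0%N + comb us' (f \o succn) else 0.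

Lemma eq_comb us f g :
  (forall j, (j < size us)%N -> f j = g j) -> comb us f = comb us g.
Proof.
elim: us f g => //= u us IH f g fg.
by rewrite fg // (IH _ (g \o succn)) // => j jus; rewrite /= fg.
Qed.

Lemma comb_lin us a f g :
  comb us (fun j => a *: f j + g j) = a *: comb us f + comb us g.
Proof.
elim: us f g => /= [|u us IH] f g; first by rewrite scaler0 addr0.
rewrite (IH (f \o succn) (g \o succn)) !scalerDr !scalerA [u * a]mulrC.
by rewrite addrACA.
Qed.

Lemma combB us f g : comb us (fun j => f j - g j) = comb us f - comb us g.
Proof.
rewrite -scaleN1r addrC -comb_lin; apply: eq_comb => j _.
by rewrite scaleN1r addrC.
Qed.

Lemma combZ us a f : comb us (fun j => a *: f j) = a *: comb us f.
Proof.
elim: us f => /= [|u us IH] f; first by rewrite scaler0.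
by rewrite (IH (f \o succn)) scalerDr !scalerA mulrC.
Qed.

Lemma comb_cat us vs f :
  comb (us ++ vs) f = comb us f + comb vs (fun j => f (size us + j)%N).
Proof.
elim: us f => /= [|u us IH] f; first by rewrite add0r; apply: eq_comb.
by rewrite IH addrA; congr (_ + _); apply: eq_comb.
Qed.

Lemma comb_map x us f : comb [seq x * u | u <- us] f = x *: comb us f.
Proof.
elim: us f => /= [|u us IH] f; first by rewrite scaler0.
by rewrite IH scalerDr scalerA.
Qed.

Lemma comb_sm X us f :
  (forall j, (j < size us)%N -> X (us`_j *: f j)) -> X (comb us f).
Proof.
elim: us f => /= [|u us IH] f Xf; first exact: sm0.
by apply: smD; [apply: (Xf 0%N)|apply: IH => j jus; apply: (Xf j.+1)].
Qed.

Lemma lcP us K v : lc us K v <-> exists2 f, (forall j, K (f j)) & v = comb us f.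
Proof.
elim: us v => /= [|u us IH] v.
  by split=> [->|[f _ ->] //]; exists (fun=> 0) => // j; exact: sm0.
split=> [[_ [w [[k Kk ->] /IH [f Kf ->] ->]]]|[f Kf ->]].
  by exists (fun j => if j is j'.+1 then f j' else k) => // -[].
exists (u *: f 0%N), (comb us (f \o succn)); split=> //; first by exists (f 0%N).
by apply/IH; exists (f \o succn) => // j; apply: Kf.
Qed.

Lemma lc_mem us K u k : u \in us -> K k -> lc us K (u *: k).
Proof.
elim: us => //= u' us IH; rewrite inE => /predU1P [<-|uus] Kk.
  by apply: addml; exists k.
by apply: addmr; exact: IH.
Qed.

Lemma lc_min us K X :
  (forall u k, u \in us -> K k -> X (u *: k)) -> lc us K `<=` X.
Proof.
elim: us => [_ _ -> |u us IH uX]; first exact: sm0.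
apply: addm_min => [_ [k Kk ->]|]; first by apply: uX => //; exact: mem_head.
by apply: IH => u' k uus; apply: uX; rewrite inE uus orbT.
Qed.

Lemma lcS us K K' : K `<=` K' -> lc us K `<=` lc us K'.
Proof. by move=> KK'; apply: lc_min => u k uus /KK'; exact: lc_mem. Qed.

Lemma lc_sub us vs K : {subset us <= vs} -> lc us K `<=` lc vs K.
Proof. by move=> usvs; apply: lc_min => u k /usvs; exact: lc_mem. Qed.

Lemma lc_subr us K : lc us K `<=` K.
Proof. by apply: lc_min => u k _; exact: smZ. Qed.

Lemma lc_lcS us vs K : lc us (lc vs K) `<=` lc vs (lc us K).
Proof.
apply: lc_min => u k uus; apply: (@lc_min _ _ (divm _ _)) => v k' vvs Kk'.
by rewrite divmE scalerA mulrC -scalerA; do 2!apply: lc_mem => //.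
Qed.

Lemma lc_lcC us vs K : lc us (lc vs K) = lc vs (lc us K).
Proof. by apply: submodule_eqE; split; exact: lc_lcS. Qed.

Lemma lc_cat us vs K : lc (us ++ vs) K = addm (lc us K) (lc vs K).
Proof.
elim: us => /= [|u us ->]; last by rewrite addmA.
apply: submodule_ext => v; split; first exact: addmr.
by move=> [_ [w [-> ? ->]]]; rewrite add0r.
Qed.

Lemma lc_map x us K : lc [seq x * u | u <- us] K = scal x (lc us K).
Proof.
elim: us => /= [|u us ->].
  apply: submodule_ext => v; split=> [->|[k -> ->]]; last by rewrite /= scaler0.
  by exists 0 => //; rewrite scaler0.
apply: submodule_ext => v; split.
  move=> [_ [_ [[k Kk ->] [l Kl ->] ->]]].
  exists (u *: k + l); last by rewrite scalerDr scalerA.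
  by exists (u *: k), l; split=> //; exists k.
move=> [_ [_ [l [[k Kk ->] Kl ->]] ->]].
exists ((x * u) *: k), (x *: l); split; [by exists k|by exists l|].
by rewrite scalerDr scalerA.
Qed.

End Calculus.

Arguments lc {A V} us K.
Arguments zerom {A V}.

Notation gen V xs := (lc xs (@topmod _ V)).

Section Ideals.
Context {A : comNzRingType}.

Lemma ideal_mull (J : ideal A) (a b : A) : J b -> J (a * b).
Proof. by move=> Jb; rewrite -[a * b]/(a *: (b : A^o)); exact: smZ. Qed.

Lemma ideal_mulr (J : ideal A) (a b : A) : J a -> J (a * b).
Proof. by rewrite mulrC; exact: ideal_mull. Qed.


Lemma ideal_scaler (J : ideal A) (a : A) (b : A^o) : J a -> J (a *: b).
Proof. by rewrite -[a *: b]/(a * (b : A)) => Ja; exact: (ideal_mulr (b : A) Ja). Qed.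

Lemma gen_act (V : lmodType A) (us : seq A) (N : submodule V) (a : A) v :
  gen A^o us a -> N v -> lc us N (a *: v).
Proof.
move=> Ja Nv; apply: (lc_min (X := colon (lc us N) v)) Ja => u k uus _.
by rewrite colonE -[u *: k]/(u * k) -scalerA; apply: lc_mem => //; exact: smZ.
Qed.

Lemma gen_mem (us : seq A) u : u \in us -> gen A^o us u.
Proof. by move=> uus; rewrite -[u]mulr1; apply: (@lc_mem _ A^o us topmod u 1). Qed.

Lemma gen_min (us : seq A) (J : ideal A) :
  (forall u, u \in us -> J u) -> gen A^o us `<=` J.
Proof.
move=> usJ; apply: lc_min => u k /usJ Ju _.
exact: ideal_scaler.
Qed.

Lemma mulmod_mem (V : lmodType A) (J : ideal A) (N : submodule V) (a : A) v :
  J a -> N v -> mulmod J N (a *: v).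
Proof. by move=> Ja Nv W [_]; apply; exists a => //; exists v. Qed.

Lemma mulmod_min (V : lmodType A) (J : ideal A) (N X : submodule V) :
  (forall (a : A) v, J a -> N v -> X (a *: v)) -> mulmod J N `<=` X.
Proof.
move=> JNX v /(_ X); apply; split; first by case: X {JNX}.
by move=> _ [a Ja] [w Nw <-]; exact: JNX.
Qed.

Lemma mulmod_gen (V : lmodType A) (us : seq A) (N : submodule V) :
  mulmod (gen A^o us) N = lc us N.
Proof.
apply: submodule_eqE; split; first by apply: mulmod_min => a v; exact: gen_act.
by apply: lc_min => u k /gen_mem; exact: mulmod_mem.
Qed.

End Ideals.

(** * Lengths of intervals of submodules *)

Section Intervals.
Context {A : comNzRingType}.

Definition ichain (V : lmodType A) (U W : submodule V) (k : nat) : Prop :=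
  has_chain (fun X => W `<=` X /\ X `<=` U) k.

Definition bounded_length (V : lmodType A) (U W : submodule V) (c : nat) : Prop :=
  forall k, ichain U W k -> (k <= c)%N.

Definition ilength (V : lmodType A) (U W : submodule V) (l : nat) : Prop :=
  chain_sup (fun X => W `<=` X /\ X `<=` U) l.

Section OneModule.
Context {V : lmodType A}.
Implicit Types (U W X Y : submodule V).

Lemma ichain0 U W : W `<=` U -> ichain U W 0.
Proof. by move=> WU; exists (fun=> U); split=> // i _; split. Qed.

Lemma ichainS U W U' W' k :
  U `<=` U' -> W' `<=` W -> ichain U W k -> ichain U' W' k.
Proof.
move=> UU' WW' [c [cP cS]]; exists c; split=> // i /cP [Wc cU].
by split; [apply: subset_trans Wc|apply: subset_trans UU'].
Qed.

Lemma bounded_lengthS U W U' W' c :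
  U' `<=` U -> W `<=` W' -> bounded_length U W c -> bounded_length U' W' c.
Proof. by move=> UU' WW' bW k /(ichainS UU' WW'); exact: bW. Qed.

Lemma ichain_top U U' W k : W `<=` U -> U `<` U' -> ichain U W k -> ichain U' W k.+1.
Proof.
move=> WU [UU' nU] [c [cP cS]].
exists (fun i => if (i <= k)%N then c i else U'); split=> i ik.
  case: ifP => [/cP [Wc cU]|_]; first by split=> //; exact: subset_trans UU'.
  by split=> //; exact: subset_trans UU'.
rewrite -ltnS ik; case: ifP => [|ik']; first exact: cS.
have -> : i = k by lia.
have [_ cU] := cP k (leqnn k).
by split=> [|U'c]; [exact: subset_trans UU'|apply: nU; exact: subset_trans cU].
Qed.

Lemma ichain_bot U W W' k :
  W' `<=` U -> W `<` W' -> ichain U W' k -> ichain U W k.+1.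
Proof.
move=> WU [WW' nW] [c [cP cS]].
exists (fun i => if i is j.+1 then c j else W); split=> -[|i] ik.
- by split=> //; exact: subset_trans WU.
- by have [Wc cU] := cP i ik; split=> //; exact: subset_trans Wc.
- have [Wc cU] := cP 0%N isT.
  by split=> [|cW]; [exact: subset_trans Wc|apply: nW; exact: subset_trans cW].
- exact: cS.
Qed.

Lemma ichain_add U X W a b : W `<=` X -> X `<=` U ->
  ichain X W a -> ichain U X b -> ichain U W (a + b).
Proof.
move=> WX XU ca; elim: b U XU => [|b IH] U XU.
  by rewrite addn0 => _; exact: ichainS ca.
move=> [c [cP cS]].
have /(_ (c b)) IHb : forall Y, X `<=` Y -> ichain Y X b -> ichain Y W (a + b).
  by move=> Y; exact: IH.
have [Xcb cbU] := cP b (leqnSn b).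
have [Xcb' cbU'] := cP b.+1 (leqnn _).
rewrite addnS; apply: (ichain_top (U := c b)); first exact: subset_trans Xcb.
  have [cc nc] := cS b (leqnn _).
  by split=> [|Uc]; [exact: subset_trans cbU'|apply: nc; exact: subset_trans Uc].
apply: IHb => //; exists c; split=> i ib; last by apply: cS; lia.
split; first by have [] := cP i; rewrite // ltnW.
have : forall j, (j <= b)%N -> c (b - j)%N `<=` c b.
  elim=> [|j IHj] jb; first by rewrite subn0.
  apply: subset_trans (IHj (ltnW jb)).
  have [] := cS (b - j.+1)%N _; first by lia.
  by have -> : (b - j.+1).+1 = (b - j)%N by lia.
by move=> /(_ (b - i)%N); rewrite subKn //; apply; lia.
Qed.

(** Meeting and joining with [X] the members of a chain of [[W, U]] gives weak
    chains of [[W, X]] and [[X, U]]; by the modular law a strict step stays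
    strict in at least one of them. *)
Lemma ichain_split U X W k : W `<=` X -> X `<=` U -> ichain U W k ->
  exists a b, [/\ ichain X W a, ichain U X b & (k <= a + b)%N].
Proof.
move=> WX XU [c [cP cS]].
suff [j jk] : exists a b, [/\ ichain (capm (c k) X) W a,
    ichain (addm (c k) X) X b & (k <= a + b)%N].
  move: jk => [b [ca cb kab]]; exists j, b; split=> //.
    by apply: ichainS ca => // v [].
  by apply: ichainS cb => //; apply: addm_min => //; have [] := cP k (leqnn k).
have {U XU cP} cW i : (i <= k)%N -> W `<=` c i by move=> /cP [].
elim: k cW cS => [|k IH] cW cS.
  exists 0%N, 0%N; split=> //; apply: ichain0; last exact: addmr.
  by move=> v Wv; split; [exact: cW|exact: WX].
have [||a [b [ca cb kab]]] := IH; [by move=> i ik; apply: cW; lia| |].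
  by move=> i ik; apply: cS; lia.
have [cc nc] := cS k (leqnn _).
have Wck := cW _ (leqnSn k); have WckS := cW _ (leqnn k.+1).
have capS : capm (c k) X `<=` capm (c k.+1) X by move=> v [/cc].
have addS : addm (c k) X `<=` addm (c k.+1) X.
  by apply: addm_min => v ?; [apply/addml/cc|apply: addmr].
have [capE|ncap] := pselect (capm (c k.+1) X `<=` capm (c k) X).
  exists a, b.+1; rewrite addnS; split=> //; first exact: ichainS ca.
  apply: ichain_top cb; first exact: addmr.
  split=> // addE; apply: nc => v cv.
  have [w [x [cw Xx vE]]] := addE v (addml _ cv).
  have cx : c k.+1 x by apply: smDl (cc _ cw) _; rewrite -vE.
  by rewrite vE; apply: smD => //; have [] := capE x (conj cx Xx).
exists a.+1, b; rewrite addSn; split=> //; last exact: ichainS cb.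
by apply: ichain_top ca => // v Wv; split; [exact: Wck|exact: WX].
Qed.

Lemma bounded_length_add U X W a b : W `<=` X -> X `<=` U ->
  bounded_length X W a -> bounded_length U X b -> bounded_length U W (a + b).
Proof.
move=> WX XU ba bb k /(ichain_split WX XU) [a' [b' [/ba ? /bb ? ?]]]; lia.
Qed.

Lemma ilength_add U X W a b : W `<=` X -> X `<=` U ->
  ilength X W a -> ilength U X b -> ilength U W (a + b).
Proof.
move=> WX XU [ca ba] [cb bb]; split; first exact: ichain_add XU ca cb.
exact: bounded_length_add ba bb.
Qed.

Lemma ilength_exists U W c : W `<=` U -> bounded_length U W c ->
  exists l, ilength U W l.
Proof.
move=> WU bW; pose P k := `[< ichain U W k >].
have exP : exists k, P k by exists 0%N; apply/asboolP; exact: ichain0.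
have ubP k : P k -> (k <= c)%N by move=> /asboolP /bW.
have [l /asboolP cl ml] := ex_maxnP exP ubP.
by exists l; split=> // k ck; apply: ml; apply/asboolP.
Qed.

Lemma ilengthxx U : ilength U U 0.
Proof.
split; first exact: ichain0.
move=> [//|k] [c [cP cS]]; have [_ []] := cS 0%N isT.
by have [_ cU] := cP 1%N isT; have [Uc _] := cP 0%N isT; exact: subset_trans cU Uc.
Qed.

Lemma bounded_length_refl U W : U `<=` W -> bounded_length U W 0.
Proof.
move=> UW [//|k] [c [cP cS]]; have [_ []] := cS 0%N isT.
have [_ cU] := cP 1%N isT; have [Wc _] := cP 0%N isT.
by apply: subset_trans (subset_trans cU UW) Wc.
Qed.

(** A chain between [W] and [W + Av] is determined by the ideals
    [(X : v)], all of which contain [Q]. *)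
Lemma bounded_length_line (Q : ideal A) (W U : submodule V) v c :
  (forall a, Q a -> W ((a : A) *: v)) ->
  (forall x, U x -> exists (a : A) w, W w /\ x = a *: v + w) ->
  bounded_length topmod Q c -> bounded_length U W c.
Proof.
move=> QW UP bQ k [c' [cP cS]]; apply: bQ.
exists (fun i => colon (c' i) v); split=> i ik.
  by split=> // a /QW; have [Wc _] := cP i ik; exact: Wc.
have [cc nc] := cS i ik; split=> [a /cc //|sub]; apply: nc => x cx.
have [_ cU] := cP _ ik; have [Wc _] := cP i (ltnW ik).
have [a [w [Ww xE]]] := UP x (cU x cx).
rewrite xE; apply: smD; last exact: Wc.
apply: (sub a); rewrite colonE; have -> : a *: v = x - w by rewrite xE addrK.
by apply: smB => //; apply/cc/Wc.
Qed.

End OneModule.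

(** Goursat's correspondence: a linear relation between [Z] and [Z'] under
    which [B] and [B'] correspond to 0 carries the chains of [[B, Z]] to chains
    of [[B', Z']]. *)
Lemma ichain_corr (V V' : lmodType A) (R : V -> V' -> Prop)
    (Z B : submodule V) (Z' B' : submodule V') k :
  (forall (a : A) u v u' v', R u u' -> R v v' -> R (a *: u + v) (a *: u' + v')) ->
  R 0 0 -> B `<=` Z ->
  (forall v, Z v -> exists v', R v v') ->
  (forall v v', R v v' -> Z v -> Z' v') ->
  (forall v', B' v' -> exists2 v, B v & R v v') ->
  (forall v, R v 0 -> Z v -> B v) ->
  ichain Z B k -> ichain Z' B' k.
Proof.
move=> Rlin R0 BZ RZ RZ' RB' RB [c [cP cS]].
have push_sub (X : submodule V) :
    is_submodule (fun v' => exists2 v, X v & R v v').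
  split=> [|a u v [u' Xu Ru] [v' Xv Rv]]; first by exists 0 => //; exact: sm0.
  by exists (a *: u' + v'); [exact: smZD|exact: Rlin].
exists (fun i => Submodule (push_sub (c i))); split=> i ik.
  have [Bc cZ] := cP i ik; split=> [v' /RB' [v /Bc cv Rv]|v' [v /cZ Zv Rv]].
    by exists v.
  exact: RZ' Rv Zv.
have [cc nc] := cS i ik; have [_ cZ] := cP _ ik; have [Bc _] := cP i (ltnW ik).
split=> [v' [v /cc cv Rv]|pushE]; first by exists v.
apply: nc => v cv; have [v' Rv] := RZ v (cZ v cv).
have [w cw Rw] : Submodule (push_sub (c i)) v' by apply: pushE; exists v.
rewrite -[v](subrK w); apply: smD => //; apply/Bc/RB.
  by have := Rlin (-1) _ _ _ _ Rw Rv; rewrite !scaleN1r addNr addrC.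
by apply: smB; apply: cZ => //; exact: cc.
Qed.

Lemma ilength_corr (V V' : lmodType A) (R : V -> V' -> Prop)
    (Z B : submodule V) (Z' B' : submodule V') l :
  (forall (a : A) u v u' v', R u u' -> R v v' -> R (a *: u + v) (a *: u' + v')) ->
  R 0 0 -> B `<=` Z -> B' `<=` Z' ->
  (forall v v', R v v' -> Z v /\ Z' v') ->
  (forall v, Z v -> exists v', R v v') ->
  (forall v', Z' v' -> exists v, R v v') ->
  (forall v, B v -> exists2 v', B' v' & R v v') ->
  (forall v', B' v' -> exists2 v, B v & R v v') ->
  (forall v, R v 0 -> B v) ->
  (forall v', R 0 v' -> B' v') ->
  ilength Z B l -> ilength Z' B' l.
Proof.
move=> Rlin R0 BZ BZ' RZ RZ1 RZ2 RB1 RB2 RB RB' [cl bl].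
have corrE k : ichain Z B k <-> ichain Z' B' k.
  split; first by apply: (ichain_corr (R := R)) => // [v v' /RZ []|v /RB].
  apply: (ichain_corr (R := fun v v' => R v' v)) => //.
  - by move=> a u v u' v'; exact: Rlin.
  - by move=> v v' /RZ [].
  - by move=> v /RB'.
by split; [exact/corrE|move=> k /corrE; exact: bl].
Qed.

(** If the combinations [\sum_j u_j w_j] with the [w_j] in [Z] lie in [B'] only
    when all [w_j] lie in [B], then modulo [B'] they form a direct sum of copies
    of [Z / B]. Adding the [u_j] one at a time filters it with all quotients
    isomorphic to [Z / B]. *)
Lemma ilength_lc (V : lmodType A) (us : seq A) (Z B B' : submodule V) l :
  B `<=` Z -> (forall u b, u \in us -> B b -> B' (u *: b)) ->
  (forall f, (forall j, Z (f j)) -> B' (comb us f) ->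
     forall j, (j < size us)%N -> B (f j)) ->
  ilength Z B l -> ilength (addm (lc us Z) B') B' (size us * l).
Proof.
move=> BZ; elim: us => [|u us IH] usB indep lenZ.
  have -> : addm (lc [::] Z) B' = B'.
    apply: submodule_eqE; split; last exact: addmr.
    by apply: addm_min => // _ ->; exact: sm0.
  exact: ilengthxx.
have len_us : ilength (addm (lc us Z) B') B' (size us * l).
  apply: IH => // [u' b u'us|f Zf Bf j jus].
    by apply: usB; rewrite inE u'us orbT.
  apply: (indep (fun j => if j is i.+1 then f i else 0) _ _ j.+1) => //.
    by move=> -[|i] //; exact: sm0.
  by rewrite /= scaler0 add0r.
rewrite /= -addmA mulSn addnC.
set W := addm (lc us Z) B' in len_us *.
apply: ilength_add len_us _; [exact: addmr|exact: addmr|].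
apply: (ilength_corr (R := fun w x => Z w /\ W (x - u *: w))) lenZ => //.
- move=> a w v x y [Zw Ww] [Zv Wv]; split; first exact: smZD.
  have -> : a *: x + y - u *: (a *: w + v) =
      a *: (x - u *: w) + (y - u *: v).
    by rewrite scalerBr scalerDr !scalerA [u * a]mulrC opprD addrACA.
  exact: smZD.
- by split; [exact: sm0|rewrite scaler0 subr0; exact: sm0].
- exact: addmr.
- move=> w x [Zw Ww]; split=> //.
  rewrite -[x](subrK (u *: w)); apply: smD; first exact: addmr.
  by apply: addml; exists w.
- by move=> w Zw; exists (u *: w); rewrite subrr; split=> //; exact: sm0.
- move=> _ [_ [y [[w Zw ->] Wy ->]]]; exists w; split=> //.
  by rewrite addrC addKr.
- move=> b Bb; exists 0; first exact: sm0.
  split; first exact: BZ.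
  rewrite sub0r -scalerN; apply/addmr/usB; first exact: mem_head.
  by rewrite -scaleN1r; exact: smZ.
- move=> x Wx; exists 0; first exact: sm0.
  by rewrite scaler0 subr0; split=> //; exact: sm0.
- move=> w []; rewrite sub0r => Zw /smN [_ [b [/lcP [f Zf ->] Bb uwE]]].
  apply: (indep (fun j => if j is i.+1 then - f i else w) _ _ 0%N) => //.
    by move=> -[|i] //; rewrite -scaleN1r; exact: smZ.
  rewrite /= uwE -[comb us (_ \o _)]/(comb us (fun j => - f j)).
  have -> : comb us (fun j => - f j) = - comb us f.
    by rewrite -scaleN1r -combZ; apply: eq_comb => j _; rewrite scaleN1r.
  by rewrite addrAC addrN add0r.
- by move=> x []; rewrite scaler0 subr0.
Qed.

End Intervals.

(** * Noetherian modules *)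

Section Noetherian.
Context {A : comNzRingType}.

Definition noetherian_module (V : lmodType A) : Prop :=
  forall W : submodule V, finitely_generated W.

Lemma noeth_max (V : lmodType A) (P : submodule V -> Prop) W0 :
  noetherian_module V -> P W0 ->
  exists2 W, P W & forall X, P X -> W `<=` X -> X `<=` W.
Proof.
move=> noethV PW0; apply: contrapT => noMax.
have /choice [next nextP] (W : {W | P W}) : exists X : {W | P W},
    proj1_sig W `<` proj1_sig X.
  apply: contrapT => noX; apply: noMax; exists (proj1_sig W); first by case: W noX.
  move=> X PX WX; apply: contrapT => nX; apply: noX.
  by exists (exist _ X PX); split.
pose c n : submodule V := proj1_sig (iter n next (exist _ W0 PW0)).
have cS n : c n `<` c n.+1 by exact: nextP.
have cD n k : c n `<=` c (n + k)%N.
  elim: k => [|k IH]; first by rewrite addn0.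
  by rewrite addnS; have [cc _] := cS (n + k)%N; exact: subset_trans cc.
have cle n k : (n <= k)%N -> c n `<=` c k by move=> /subnKC <-.
have union_sub : is_submodule (fun v : V => exists n, c n v).
  split=> [|a u v [i cu] [j cv]]; first by exists 0%N; exact: sm0.
  exists (maxn i j); apply: smZD.
    exact: cle (leq_maxl _ _) _ cu.
  exact: cle (leq_maxr _ _) _ cv.
have [k [s sP]] := noethV (Submodule union_sub).
have /choice [n nP] (i : 'I_k) : exists n, c n (s i).
  have /(sP (s i)) : exists a : 'I_k -> A, s i = \sum_j a j *: s j.
    exists (fun j => (j == i)%:R).
    rewrite (bigD1 i) //= eqxx scale1r big1 ?addr0 // => j /negPf ->.
    by rewrite scale0r.
  by [].
have [_ []] := cS (\max_i n i)%N => v cv.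
have /(sP v) [a ->] : exists n, c n v by exists (\max_i n i).+1.
apply: sm_sum => i; apply: smZ; apply: cle (nP i).
exact: (leq_bigmax i).
Qed.

Hypothesis noethA : noetherian A.

Lemma noetherian_fg (V : lmodType A) :
  finitely_generated [set: V] -> noetherian_module V.
Proof.
move=> [n [e eP]] W.
have K_sub : is_submodule
    (fun a : {ffun 'I_n -> A^o} => W (\sum_j (a j : A) *: e j)).
  split=> [|a u v Wu Wv].
    by rewrite big1 => [|j _]; [exact: sm0|rewrite ffunE scale0r].
  rewrite (eq_bigr (fun j => a *: ((u j : A) *: e j) + (v j : A) *: e j)).
    by rewrite big_split -scaler_sumr; exact: smZD.
  by move=> j _; rewrite !ffunE scalerDl scalerA.
have [p [s sP]] := noetherian_ffun noethA (Submodule K_sub).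
pose t i : V := \sum_j (s i j : A) *: e j.
have Wt i : W (t i).
  have /(sP (s i)) : exists a : 'I_p -> A, s i = \sum_j a j *: s j.
    exists (fun j => (j == i)%:R).
    rewrite (bigD1 i) //= eqxx scale1r big1 ?addr0 // => j /negPf ->.
    by rewrite scale0r.
  by [].
exists p, t => v; split=> [Wv|[a ->]]; last first.
  by apply: sm_sum => i; apply: smZ.
have [/(_ I) [a vE] _] := eP v.
have /(sP [ffun j => a j]) [b bE] : Submodule K_sub [ffun j => a j].
  suff : W (\sum_j ([ffun j => a j] j : A) *: e j) by [].
  rewrite (eq_bigr (fun j => a j *: e j)) -?vE // => j _.
  by rewrite ffunE.
exists b; rewrite vE.
transitivity (\sum_j (\sum_i (b i * s i j)) *: e j).
  apply: eq_bigr => j _; congr (_ *: _).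
  have := congr1 (fun f : {ffun 'I_n -> A^o} => f j) bE.
  rewrite ffunE sum_ffunE => ->; apply: eq_bigr => i _; by rewrite ffunE.
under eq_bigr => j _ do rewrite scaler_suml.
rewrite exchange_big; apply: eq_bigr => i _; rewrite scaler_sumr.
by apply: eq_bigr => j _; rewrite scalerA.
Qed.

Lemma ideal_gen (J : ideal A) : exists xs, J = gen A^o xs.
Proof.
have [n [s sP]] := noethA J.
exists [seq s i | i <- enum 'I_n]; apply: submodule_eqE; split=> [v /(sP v) [a ->]|].
  apply: sm_sum => i; apply: smZ; apply: gen_mem.
  by apply: map_f; rewrite mem_enum.
apply: gen_min => u /mapP [i _ ->]; apply/sP; exists (fun j => (j == i)%:R).
rewrite (bigD1 i) //= eqxx scale1r big1 ?addr0 // => j /negPf ->.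
by rewrite scale0r.
Qed.

Lemma noetherian_ring_module : noetherian_module A^o.
Proof. exact: noethA. Qed.

End Noetherian.

(** * Local rings *)

Section Local.
Context {A : comNzRingType} (m : ideal A).
Hypotheses (noethA : noetherian A) (localA : local_ring m).

Lemma proper_sub_max (J : ideal A) : ~ J 1 -> J `<=` m.
Proof.
move=> J1; pose P (X : submodule A^o) := J `<=` X /\ ~ X 1.
have [X [JX X1] maxX] := @noeth_max _ _ P J (noetherian_ring_module noethA) (conj (fun x y => y) J1).
have [_ /(_ X)] := localA; case=> [|Xm _]; last exact: subset_trans Xm.
by split=> // Y XY Y1; apply: maxX => //; split=> //; exact: subset_trans XY.
Qed.

Lemma max1 : ~ m 1. Proof. by have [[]] := localA. Qed.

Lemma unit_notin (a : A) : ~ m a -> exists b, b * a = 1.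
Proof.
move=> ma; apply: contrapT => nb; apply: ma.
apply: (@proper_sub_max (gen A^o [:: a])); last by apply/gen_mem/mem_head.
move=> [_ [_ [[k _ ->] -> ]]]; rewrite addr0 => ak.
by apply: nb; exists k; rewrite mulrC ak.
Qed.

Lemma max_prime : prime_ideal m.
Proof.
split=> [|x y mxy]; first exact: max1.
have [|nx] := pselect (m x); [by left|right].
by have [b bx] := unit_notin nx; rewrite -[y]mul1r -bx -mulrA; exact: ideal_mull.
Qed.

Lemma max_exp (x : A) n : m (x ^+ n) -> m x.
Proof.
elim: n => [/max1 //|n IH]; rewrite exprS => mx.
by case: max_prime => _ /(_ _ _ mx) [].
Qed.

(** Nakayama: if [U] were not contained in [W], then a maximal proper
    submodule of [U] among those above [W] would contain [mU]. *)
Lemma nakayama (V : lmodType A) (W U : submodule V) :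
  noetherian_module V -> U `<=` addm W (mulmod m U) -> U `<=` W.
Proof.
move=> noethV UWU; apply: contrapT => nUW.
pose P (X : submodule V) := capm W U `<=` X /\ X `<=` U /\ ~ (U `<=` X).
have [|X [WX [XU nUX]] maxX] := @noeth_max _ _ P (capm W U) noethV.
  by split=> //; split=> [v []//|UW]; apply: nUW => v /UW [].
have mUX : mulmod m U `<=` X.
  apply: mulmod_min => a u ma Uu; apply: contrapT => nX.
  (* [X + A (au)] would be all of [U], so that [u] is in [X + A (au)], where [1]
     minus a multiple of [a] is a unit. *)
  pose L := addm X (line (a *: u)).
  have LU : U `<=` L.
    apply: contrapT => nUL; apply: nX; apply: (maxX L).
    - split; first by move=> v /WX Xv; exact: addml.
      split=> //; apply: addm_min => // _ [b ->].
      by do 2!apply: smZ.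
    - by move=> v; exact: addml.
    - by apply: addmr; exact: line_mem.
  have [x [_ [Xx [b ->] uE]]] := LU u Uu.
  have [c cE] : exists c, c * (1 - b * a) = 1.
    apply: unit_notin => mba; apply: max1.
    by rewrite -[1](subrK (b * a)); apply: smD => //; exact: ideal_mull.
  apply: nX; apply: smZ; rewrite -[u]scale1r -cE -scalerA; apply: smZ.
  by rewrite scalerBl scale1r -scalerA {1}uE addrK.
apply: nUX => u Uu; have [w [z [Ww mUz uE]]] := UWU u Uu.
rewrite uE; apply: smD; last exact: mUX.
apply: WX; split=> //; apply: (smDl (u := z)); last by rewrite addrC -uE.
by apply: mulmod_min mUz => a v _; exact: smZ.
Qed.

Lemma bounded_max : bounded_length (@topmod _ A^o) m 1.
Proof.
move=> [|[|k]] // [c [cP cS]]; have [_ []] := cS 1%N isT.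
have [mc _] := cP 1%N isT; have [mc0 _] := cP 0%N isT.
have [c01 nc01] := cS 0%N isT.
have [c1|c1] := pselect (c 1%N 1).
  by move=> x _; rewrite -[x]mulr1; exact: ideal_mull.
by case: nc01 => x /(proper_sub_max c1) /mc0.
Qed.

Section Avoidance.
Hypothesis infinite_residue : infinite_set [set: quot m].

Lemma residue_sequence : exists t : nat -> A, forall i j, m (t i - t j) -> i = j.
Proof.
have /infiniteP/card_leP [f] := infinite_residue.
pose g (i : nat) : quot m := val (f (exist _ i (mem_set Logic.I))).
have ginj i j : g i = g j -> i = j.
  move=> /val_inj fij.
  by have [] := @inj _ _ _ f _ _ (mem_set Logic.I) (mem_set Logic.I) fij.
have /choice [t tP] (i : nat) : exists a, g i = quot_pi m a.
  exact: quot_pi_surj.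
by exists t => i j /quot_piP; rewrite -!tP => /ginj.
Qed.

Lemma eventually_all r (P : nat -> nat -> Prop) :
  (forall i, (i < r)%N -> exists K, forall k, (K <= k)%N -> P i k) ->
  exists K, forall k, (K <= k)%N -> forall i, (i < r)%N -> P i k.
Proof.
elim: r => [|r IH] PK; first by exists 0%N.
have [|K KP] := IH; first by move=> i ir; apply: PK; lia.
have [K' KP'] := PK r (leqnn _).
exists (maxn K K') => k; rewrite geq_max => /andP [Kk K'k] i.
by rewrite ltnS leq_eqVlt => /predU1P [->|]; [exact: KP'|exact: KP].
Qed.

(** At most one residue class of [t] makes [v + tu] fall into a submodule
    that does not contain both [u] and [v]. *)
Lemma avoid_union (V : lmodType A) (J : submodule V) r (W : nat -> submodule V) :
  (forall i, (i < r)%N -> ~ (J `<=` W i)) ->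
  exists2 z, J z & forall i, (i < r)%N -> ~ W i z.
Proof.
have [t tinj] := residue_sequence.
elim: r => [_|r IH nJ]; first by exists 0 => //; exact: sm0.
have [|v Jv nv] := IH; first by move=> i ir; apply: nJ; lia.
have [u /not_implyP [Ju nu]] : exists u, ~ (J u -> W r u).
  by apply/existsNP => JW; apply: (nJ r).
have [|K KP] := @eventually_all r.+1 (fun i k => ~ W i (v + t k *: u)).
  move=> i ir; apply: contrapT => /forallNP nK.
  have ex K : exists2 k, (K <= k)%N & W i (v + t k *: u).
    have /existsNP [k /not_implyP [Kk /contrapT Wk]] := nK K.
    by exists k.
  have [k _ Wk] := ex 0%N; have [l kl Wl] := ex k.+1.
  have [|c cE] := @unit_notin (t l - t k); first by move=> /tinj lk; lia.
  have Wu : W i u.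
    rewrite -[u]scale1r -cE -scalerA; apply: smZ; rewrite scalerBl.
    by have := smB Wl Wk; rewrite addrAC opprD addrA addrN add0r addrC.
  move: ir; rewrite ltnS leq_eqVlt => /predU1P [ir|ir]; first by apply: nu; rewrite -ir.
  apply: (nv i ir); apply: (smDl (u := t k *: u)); first exact: smZ.
  by rewrite addrC.
exists (v + t K *: u); first by apply: smD => //; exact: smZ.
exact: KP.
Qed.

End Avoidance.

End Local.

(** * Regular elements and regular sequences *)

Section Regular.
Context {A : comNzRingType}.

(** [z] is a nonzerodivisor on [V / W]. *)
Definition regmod (V : lmodType A) (W : submodule V) (z : A) : Prop :=
  forall v, W (z *: v) -> W v.

Lemma regmod_exp (V : lmodType A) (W : submodule V) (z : A) n v :
  regmod W z -> W (z ^+ n *: v) -> W v.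
Proof.
move=> zW; elim: n => [|n IH]; first by rewrite scale1r.
by rewrite exprS -scalerA => /zW.
Qed.

(** By definition, [gen V (z :: xs)] is [addz (gen V xs) z]. *)
Definition addz (V : lmodType A) (W : submodule V) (z : A) : submodule V :=
  addm (scal z topmod) W.

Fixpoint regseq (V : lmodType A) (W : submodule V) (ys : seq A) : Prop :=
  if ys is y :: ys' then regmod W y /\ regseq (addz W y) ys' else True.

(** The last member of [ys] is left out of the moduli: it is the one given up
    in [regseq_exchange]. *)
Fixpoint reg_all (V : lmodType A) (W : submodule V) (ys : seq A) (z : A) : Prop :=
  if ys is y :: ys' then regmod W z /\ reg_all (addz W y) ys' z else True.

(** Sequences that grow at the head: in [x :: xs], the element [x] is a
    nonzerodivisor on [V / (xs)V]. *)
Fixpoint revregular (V : lmodType A) (xs : seq A) : Prop :=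
  if xs is x :: xs' then revregular V xs' /\ regmod (gen V xs') x else True.

Lemma addzC (V : lmodType A) (W : submodule V) y z :
  addz (addz W y) z = addz (addz W z) y.
Proof. by rewrite /addz addmCA. Qed.

(** A nonzerodivisor may be moved to the front of a regular sequence, its last
    element being given up in exchange, provided that it stays a nonzerodivisor
    all along the sequence. *)
Lemma regseq_exchange (V : lmodType A) (W : submodule V) (ys : seq A) (y z : A) :
  regseq W (rcons ys y) -> reg_all W (rcons ys y) z -> regseq (addz W z) ys.
Proof.
elim: ys W => //= y1 ys IH W [y1W ysW] [zW zys]; split; last first.
  by rewrite addzC; exact: IH.
have zW1 : regmod (addz W y1) z by move: zys; case: (ys) => [|? ?] [].
move=> v [_ [w [[u _ ->] Ww vE]]].
have [|_ [w' [[u' _ ->] Ww' uE]]] := zW1 u.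
  exists (y1 *: v), (- w); split; first by exists v.
    by apply: smN; rewrite opprK.
  by rewrite vE addrK.
have Wv : W (v - z *: u').
  apply: y1W; rewrite scalerBr vE uE scalerDr !scalerA [z * y1]mulrC.
  rewrite -[X in X - _]addrA addrAC subrr add0r; apply: smD => //; exact: smZ.
exists (z *: u'), (v - z *: u'); split=> //; first by exists u'.
by rewrite addrC subrK.
Qed.

Section Dimension.
Hypothesis noethA : noetherian A.

Lemma exists_prime (W : ideal A) (S : A -> Prop) :
  S 1 -> (forall a b, S a -> S b -> S (a * b)) -> (forall a, W a -> ~ S a) ->
  exists P : ideal A, [/\ prime_ideal P, W `<=` P & forall a, P a -> ~ S a].
Proof.
move=> S1 SM WS; pose F (X : submodule A^o) := W `<=` X /\ forall a, X a -> ~ S a.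
have [X [WX XS] maxX] := @noeth_max _ _ F W (noetherian_ring_module noethA) (conj (fun x y => y) WS).
exists X; split=> //; split=> [/XS //|x y Xxy].
apply: contrapT => /not_orP [nx ny].
have meetS z : ~ X z -> exists a q, X q /\ S (q + a * z).
  move=> nz; apply: contrapT => noS; apply: nz.
  apply: (maxX (addm X (line (z : A^o)))).
  - split=> [v /WX|_ [q [_ [Xq [a ->] ->]]] Sq]; first exact: addml.
    by apply: noS; exists a, q.
  - by move=> v; exact: addml.
  - by apply: addmr; exact: line_mem.
have [a [q [Xq Sq]]] := meetS _ nx; have [b [q' [Xq' Sq']]] := meetS _ ny.
apply: XS (SM _ _ Sq Sq').
have -> : (q + a * x) * (q' + b * y) =
    (q' + b * y) * q + ((a * x) * q' + (a * b) * (x * y)) by ring.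
by apply: smD; [exact: ideal_mull|apply: smD; exact: ideal_mull].
Qed.

(** A nonzerodivisor modulo [W] lies in no prime ideal minimal over [W]. *)
Lemma prime_below (W P : ideal A) (y : A) :
  prime_ideal P -> W `<=` P -> P y -> regmod (V := A^o) W y ->
  exists Q : ideal A, [/\ prime_ideal Q, W `<=` Q & Q `<` P].
Proof.
move=> [P1 Pp] WP Py yW.
(* A prime disjoint from the multiplicative set generated by [y] and by the
   complement of [P] is contained in [P] and avoids [y]. *)
have [||a Wa [s [n [Ps aE]]]|Q [Qp WQ QS]] :=
    @exists_prime W (fun a => exists s n, ~ P s /\ a = y ^+ n * s).
- by exists 1, 0%N; rewrite mulr1.
- move=> _ _ [s [n [Ps ->]]] [s' [n' [Ps' ->]]].
  exists (s * s'), (n + n')%N; split; last by rewrite exprD; ring.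
  by move=> /Pp [].
- by apply/Ps/WP/(regmod_exp (n := n) yW); rewrite -[_ *: _]/(_ * _) -aE.
exists Q; split=> //; split.
  move=> a Qa; apply: contrapT => Pa; apply: (QS a Qa).
  by exists a, 0%N; rewrite mul1r.
move=> /(_ _ Py) /QS; apply; exists 1, 1%N; split=> //.
by rewrite mulr1.
Qed.

Lemma prime_chain_below (ys : seq A) (W P : ideal A) :
  prime_ideal P -> W `<=` P -> (forall y, y \in ys -> P y) ->
  regseq (V := A^o) W ys ->
  exists c : nat -> ideal A, [/\ forall i, (i <= size ys)%N -> prime_ideal (c i),
    forall i, (i < size ys)%N -> c i `<` c i.+1, W `<=` c 0%N & c (size ys) = P].
Proof.
elim: ys W => [|y ys IH] W Pp WP ysP /=; first by exists (fun=> P); split.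
move=> [yW ysW]; have Py := ysP _ (mem_head _ _).
have [//|||//|c [cp cS Wc cE]] := IH (addz W y).
- by apply: addm_min => // _ [k _ ->]; exact: ideal_scaler.
- by move=> z zys; apply: ysP; rewrite inE zys orbT.
have [||||Q [Qp WQ Qc]] := @prime_below W (c 0%N) y.
- exact: cp.
- by move=> v Wv; apply: Wc; apply: addmr.
- by apply/Wc/addml; exists 1 => //; rewrite -[y *: 1]/(y * 1) mulr1.
- exact: yW.
exists (fun i => if i is j.+1 then c j else Q); split=> //.
- by move=> [|i] // ile; exact: cp.
- by move=> [|i] // ilt; exact: cS.
Qed.

(** Each element of a regular sequence lowers the dimension, so that [m] is the
    only prime ideal containing a regular sequence of length [dim A]. *)
Lemma regseq_radical (m : ideal A) (d : nat) (ys : seq A) :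
  local_ring m -> krull_dim A d -> size ys = d -> (forall y, y \in ys -> m y) ->
  regseq (zerom : submodule A^o) ys -> forall a : A, m a -> exists n, gen A^o ys (a ^+ n).
Proof.
move=> localA [_ dimA] ysd ysm regys a ma; apply: contrapT => /forallNP an.
have [|||P [Pp ysP Pa]] := @exists_prime (gen A^o ys) (fun b => exists n, b = a ^+ n).
- by exists 0%N.
- by move=> _ _ [i ->] [j ->]; exists (i + j)%N; rewrite exprD.
- by move=> b ysb [n bE]; apply: (an n); rewrite -bE.
have [|y /gen_mem /ysP //|//|c [cp cS _ cE]] := @prime_chain_below ys zerom P Pp.
  by move=> _ ->; exact: sm0.
have Pm : P `<` m.
  split; first by apply: proper_sub_max => //; case: Pp.
  by move=> /(_ a ma) /Pa; apply; exists 1%N.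
suff /dimA : has_chain (@prime_ideal A) d.+1 by rewrite ltnn.
rewrite -{}ysd; exists (fun i => if (i <= size ys)%N then c i else m); split=> i iys.
  by case: ifP => [/cp //|_]; exact: max_prime.
rewrite -ltnS iys; case: ifP => [|iys']; first exact: cS.
have -> : i = size ys by lia. rewrite cE; exact: Pm.
Qed.

End Dimension.

End Regular.

(** * Generic elements of an ideal *)

Section Generic.
Context {A : comNzRingType} (m : ideal A).

(** Finitely many such conditions can be met together when the residue field
    is infinite, as [J] is then not a finite union of smaller ideals. *)
Definition generic (J : ideal A) (S : A -> Prop) : Prop :=
  exists r (W : nat -> ideal A), (forall i, (i < r)%N -> ~ (J `<=` W i)) /\
    forall z, J z -> (forall i, (i < r)%N -> ~ W i z) -> S z.

Lemma genericT (J : ideal A) : generic J (fun=> True).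
Proof. by exists 0%N, (fun=> J). Qed.

Lemma genericI (J : ideal A) S T :
  generic J S -> generic J T -> generic J (fun z => S z /\ T z).
Proof.
move=> [r [W [JW WS]]] [s [X [JX XT]]].
exists (r + s)%N, (fun i => if (i < r)%N then W i else X (i - r)%N); split=> [i irs|z Jz nz].
  by case: ifP => ir; [exact: JW|apply: JX; lia].
split; first by apply: WS => // i ir; have := nz i; rewrite ir; apply; lia.
apply: XT => // i ir; have -> : i = (r + i - r)%N by lia.
have /negPf rir : ~~ (r + i < r)%N by lia.
by have := nz (r + i)%N; rewrite rir; apply; lia.
Qed.

Lemma generic_notin (J W : ideal A) : ~ (J `<=` W) -> generic J (fun z => ~ W z).
Proof. by move=> JW; exists 1%N, (fun=> W); split=> // z _ /(_ 0%N isT). Qed.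

Hypothesis noethA : noetherian A.

Lemma generic_exists (J : ideal A) S :
  local_ring m -> infinite_set [set: quot m] -> generic J S -> exists2 z, J z & S z.
Proof.
move=> localA infm [r [W [JW WS]]].
have [z Jz nz] := avoid_union noethA localA infm JW.
by exists z => //; exact: WS.
Qed.

(** The zerodivisors on [V / W] lie in the maximal ones among the annihilators
    of nonzero elements. Each of these is prime, and they are finitely many:
    if [v] is a combination of [v_1, ..., v_r], then the annihilator of [v]
    contains the product of those of the [v_i], hence one of them. A power of
    the nonzerodivisor [y] keeps [J] out of all annihilators. *)
Lemma generic_regmod (V : lmodType A) (W : submodule V) (J : ideal A) (y : A) n :
  noetherian_module V -> regmod W y -> J (y ^+ n) -> generic J (regmod W).
Proof.
move=> noethV yW Jy.
(* [T v] says that the annihilator of [v] modulo [W] is maximal. *)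
pose T v := ~ W v /\
  forall v', ~ W v' -> colon W v `<=` colon W v' -> colon W v' `<=` colon W v.
have T_above v : ~ W v -> exists2 v', T v' & colon W v `<=` colon W v'.
  move=> nv.
  pose F (X : submodule A^o) :=
    exists v', [/\ ~ W v', X = colon W v' & colon W v `<=` X].
  have [|_ [v' [nv' -> vv']] max'] := @noeth_max _ _ F (colon W v) (noetherian_ring_module noethA).
    by exists v; split=> // c.
  exists v' => //; split=> // v'' nv'' v'v''; apply: max' => //.
  by exists v''; split=> //; exact: subset_trans v'v''.
have T_prime v : T v -> prime_ideal (colon W v).
  move=> [nv maxv]; split=> [|a b]; first by rewrite colonE scale1r.
  rewrite mulrC !colonE -scalerA => ab; have [|na] := pselect (W (a *: v)); first by left.
  right; apply: (maxv (a *: v)) => // c Wc; rewrite colonE scalerA mulrC -scalerA.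
  exact: smZ.
(* By noetherianity, finitely many of these [v] span the same submodule as all
   of them. *)
pose spanl := foldr (fun v X => addm (line v) X) (zerom : submodule V).
pose F X := exists2 vs, (forall i, (i < size vs)%N -> T vs`_i) & X = spanl vs.
have [|_ [vs vsT ->] maxvs] := @noeth_max _ _ F zerom noethV; first by exists [::].
have T_span v : T v -> spanl vs v.
  move=> Tv; apply: (maxvs (spanl (v :: vs))); last by apply/addml/line_mem.
    by exists (v :: vs) => // -[|i] // ilt; exact: vsT.
  by move=> x; exact: addmr.
exists (size vs), (fun i => colon W vs`_i); split=> [i ivs Jcolon|z Jz nz v zv].
  by have [ni _] := vsT i ivs; apply/ni/(regmod_exp (n := n) yW)/(Jcolon _ Jy).
apply: contrapT => /T_above [v' Tv' vv']; have z' := vv' z zv.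
have [[i [ivs iv']]|/forallNP noi] :=
    pselect (exists i, (i < size vs)%N /\ colon W vs`_i `<=` colon W v').
  by have [_ /(_ v')] := vsT i ivs; case: Tv' => nv' _ /(_ nv' iv') /(_ z z') /(nz i ivs).
have [[nv' _] [p1 pM]] := (Tv', T_prime _ Tv').
suff [b nb Wb] : exists2 b, ~ colon W v' b & forall x, spanl vs x -> W (b *: x).
  exact/nb/Wb/T_span.
have {T_span maxvs vsT nz F} : forall i, (i < size vs)%N -> ~ (colon W vs`_i `<=` colon W v').
  by move=> i ivs iv'; apply: (noi i).
elim: (vs) => [|u us IH] nus; first by exists 1 => // _ ->; rewrite scaler0; exact: sm0.
have [b nb Wb] := IH (fun i => nus i.+1).
have /existsNP [c /not_implyP [uc nc]] := nus 0%N isT.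
exists (b * c) => [/pM [] //|_ [_ [x [[a ->] xus ->]]]].
rewrite scalerDr; apply: smD.
  by rewrite -scalerA [c *: _]scalerA [c * a]mulrC -scalerA; do 2!apply: smZ.
by rewrite mulrC -scalerA; apply: smZ; exact: Wb.
Qed.

Lemma generic_reg_all (V : lmodType A) (W : submodule V) (J : ideal A) ys :
  noetherian_module V -> (forall y, y \in ys -> exists n, J (y ^+ n)) ->
  regseq W ys -> generic J (reg_all W ys).
Proof.
move=> noethV; elim: ys W => [|y ys IH] W ysJ /=; first by move=> _; exact: genericT.
move=> [yW ysW]; have [n Jy] := ysJ y (mem_head _ _); apply: genericI.
  exact: generic_regmod noethV yW Jy.
by apply: IH => // z zys; apply: ysJ; rewrite inE zys orbT.
Qed.

End Generic.

(** * Monomials *)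

Section Monomials.
Context {A : comNzRingType}.

(** The monomials of degree [n] in [xs]: first those divisible by the head,
    then those in the tail. The list depends on [xs] only through evaluation, so
    that [comb (mons xs n) f] is the value at [xs] of the form of degree [n] with
    coefficients [f]. *)
Fixpoint mons (xs : seq A) : nat -> seq A :=
  match xs with
  | [::] => fun n => if n is 0 then [:: 1] else [::]
  | x :: xs' => fix monsx n :=
      if n is k.+1 then [seq x * u | u <- monsx k] ++ mons xs' k.+1 else [:: 1]
  end.

Lemma mons0 xs : mons xs 0 = [:: 1]. Proof. by case: xs. Qed.

Lemma monsS x xs n :
  mons (x :: xs) n.+1 = [seq x * u | u <- mons (x :: xs) n] ++ mons xs n.+1.
Proof. by []. Qed.

Lemma mons_sub x xs n : {subset mons xs n <= mons (x :: xs) n}.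
Proof. by case: n => [|n] u; rewrite ?mons0 // monsS mem_cat => ->; rewrite orbT. Qed.

Lemma size_mons_cons x xs n : size (mons (x :: xs) n) = 'C(n + size xs, n).
Proof.
elim: xs x n => [|y xs IH] x; elim=> [|n IHn]; rewrite ?mons0 ?bin0 // monsS.
  by rewrite cats0 size_map IHn !addn0 !binn.
by rewrite size_cat size_map IHn IH /= [in RHS]addSn binS addnC addSnnS.
Qed.

Lemma size_mons xs ys n : size xs = size ys -> size (mons xs n) = size (mons ys n).
Proof.
case: xs ys => [|x xs] [|y ys] //= [xsys].
by rewrite -/(mons (x :: xs) n) -/(mons (y :: ys) n) !size_mons_cons xsys.
Qed.

Lemma mem_mons_cons x xs n u : u \in mons (x :: xs) n ->
  exists i v, [/\ (i <= n)%N, v \in mons xs (n - i)%N & u = x ^+ i * v].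
Proof.
elim: n u => [|n IH] u.
  by rewrite !mons0 inE => /eqP ->; exists 0%N, 1; rewrite mons0 mem_head mulr1.
rewrite monsS mem_cat => /orP [/mapP [u' /IH [i [v [ilen v_in ->]]] ->]|u_in].
  by exists i.+1, v; rewrite exprS mulrA.
by exists 0%N, u; rewrite mul1r subn0.
Qed.

Lemma mons_nilpotent (K : ideal A) xs :
  (forall x, x \in xs -> exists n, K (x ^+ n)) ->
  exists N, forall n, (N <= n)%N -> forall u, u \in mons xs n -> K u.
Proof.
elim: xs => [|x xs IH] xsK; first by exists 1%N => -[|n].
have [k Kx] := xsK x (mem_head _ _).
have [|N NP] := IH; first by move=> y yxs; apply: xsK; rewrite inE yxs orbT.
exists (N + k)%N => n Nn _ /mem_mons_cons [i [v [ilen v_in ->]]].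
have [ki|ik] := leqP k i; last by apply/ideal_mull/(NP (n - i)%N) => //; lia.
by apply: ideal_mulr; rewrite -(subnK ki) exprD; exact: ideal_mull.
Qed.

Lemma lc_mons0 (V : lmodType A) xs (K : submodule V) : lc (mons xs 0) K = K.
Proof.
rewrite mons0; apply: submodule_eqE; split; first exact: lc_subr.
by move=> k Kk; rewrite -[k]scale1r; apply: lc_mem => //; exact: mem_head.
Qed.

Lemma lc_mons_cons (V : lmodType A) x xs n (K : submodule V) :
  lc (mons (x :: xs) n.+1) K =
  addm (scal x (lc (mons (x :: xs) n) K)) (lc (mons xs n.+1) K).
Proof. by rewrite monsS lc_cat lc_map. Qed.

Lemma lc_monsS (V : lmodType A) xs n (K : submodule V) :
  lc (mons xs n.+1) K = lc xs (lc (mons xs n) K).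
Proof.
elim: xs n => [|x xs IH] n //.
suff step : lc xs (lc (mons (x :: xs) n) K) `<=` lc (mons (x :: xs) n.+1) K.
  apply: submodule_eqE; split.
    rewrite lc_mons_cons IH; apply: addm_min => v.
      by move=> xv; exact: addml.
    by move=> xsv; apply: addmr; apply: lcS xsv; apply: lc_sub; exact: mons_sub.
  apply: addm_min => // v xv; rewrite lc_mons_cons; exact: addml.
elim: n => [|n IHn].
  by rewrite lc_mons_cons IH !lc_mons0 => v; exact: addmr.
apply: lc_min => u k uxs; rewrite {1}lc_mons_cons => -[_ [l [[k' Pk' ->] Kl ->]]].
rewrite scalerDr lc_mons_cons; apply: smD; last first.
  by apply: addmr; rewrite IH; exact: lc_mem.
apply: addml; exists (u *: k'); last by rewrite !scalerA mulrC.
by apply/IHn/lc_mem.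
Qed.

Lemma lc_monsD (V : lmodType A) xs n k (K : submodule V) :
  lc (mons xs (n + k)) K = lc (mons xs n) (lc (mons xs k) K).
Proof.
by elim: n => [|n IH]; rewrite ?lc_mons0 // addSn !lc_monsS IH.
Qed.

Lemma gen_monsS (V : lmodType A) xs n :
  gen V (mons xs n.+1) = lc (mons xs n) (gen V xs).
Proof. by rewrite lc_monsS lc_lcC. Qed.

Lemma exp_gen_mons x xs n : x \in xs -> gen A^o (mons xs n) (x ^+ n).
Proof.
move=> xxs; elim: n => [|n IH]; first by apply: gen_mem; rewrite mons0 mem_head.
by rewrite lc_monsS exprS; exact: (lc_mem (V := A^o)).
Qed.

(** * Quasi-regular sequences *)

Section Independence.
Variables (V : lmodType A) (us : seq A) (J K : submodule V).
Hypothesis indep :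
  forall f, comb us f = 0 -> forall j, (j < size us)%N -> J (f j).

Lemma comb_in_lc f : J `<=` K -> lc us K (comb us f) ->
  forall j, (j < size us)%N -> K (f j).
Proof.
move=> JK /lcP [g Kg fg] j jus; rewrite -[f j](subrK (g j)); apply: smD => //.
by apply/JK/(indep (f := fun j => f j - g j)) => //; rewrite combB fg subrr.
Qed.

End Independence.

Lemma comb_lc (V : lmodType A) (us : seq A) (K : submodule V) f :
  (forall j, (j < size us)%N -> K (f j)) -> lc us K (comb us f).
Proof. by move=> Kf; apply: comb_sm => j jus; apply: lc_mem (Kf j jus); exact: mem_nth. Qed.

(** The powers of an ideal that is quasi-regular inherit the nonzerodivisors of
    its residue ring, because the successive quotients are free over it. *)
Lemma regmod_mons xs x n :
  (forall k (f : nat -> A^o), comb (mons xs k) f = 0 ->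
     forall j, (j < size (mons xs k))%N -> gen A^o xs (f j)) ->
  regmod (gen A^o xs) x -> regmod (gen A^o (mons xs n)) x.
Proof.
move=> quasi xreg; elim: n => [|n IH] v; first by rewrite lc_mons0.
rewrite gen_monsS => xv.
have /lcP [f _ vE] : gen A^o (mons xs n) v by apply: IH; exact: lcS xv.
rewrite vE -combZ in xv *; apply: comb_lc => j jus; apply: xreg.
exact: (comb_in_lc (quasi n) _ xv).
Qed.

(** Rees: a regular sequence is quasi-regular. Write a form of degree [n + 1]
    as [x g + h] with [h] free of [x]. If it vanishes at the sequence, then [g]
    takes a value in the [(n + 1)]st power of the ideal of the tail, since [x] is
    a nonzerodivisor modulo that power. So [g], up to coefficients in the ideal,
    vanishes too, and so does the form [h + x h'] in the tail. *)
Lemma quasi_regular xs n (f : nat -> A^o) : revregular A^o xs ->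
  comb (mons xs n) f = 0 ->
  forall j, (j < size (mons xs n))%N -> gen A^o xs (f j).
Proof.
elim: xs n f => [|x xs IH] n f.
  by case: n => // _ /=; rewrite scale1r addr0 => f0 [|j].
move=> [xsreg xreg]; have quasi k g := IH k g xsreg; move=> {IH}.
elim: n f => [|n IHn] f.
  by rewrite mons0 /= scale1r addr0 => f0 [|j] //= _; rewrite f0; exact: sm0.
rewrite monsS; set us := mons (x :: xs) n in IHn *; set vs := mons xs n.+1.
rewrite comb_cat size_map comb_map; set f' := fun j => f (size us + j)%N => fE.
have gvs : gen A^o vs (comb us f).
  apply: (regmod_mons quasi xreg); rewrite -[_ *: _](addrK (comb vs f')) fE sub0r.
  by rewrite -scaleN1r; apply: smZ; exact: comb_lc.
have fus j : (j < size us)%N -> gen A^o (x :: xs) (f j).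
  have : lc us (gen A^o xs) (comb us f).
    move: gvs; rewrite gen_monsS; apply: lc_sub; exact: mons_sub.
  move=> /lcP [g gxs fg] jus; rewrite -[f j](subrK (g j)); apply: smD.
    by apply: (IHn (fun j => f j - g j)) => //; rewrite combB fg subrr.
  exact: addmr.
move: gvs => /lcP [h _ fh].
have fvs j : (j < size vs)%N -> gen A^o xs (x *: h j + f' j).
  apply: (quasi n.+1 (fun j => x *: h j + f' j)).
  by rewrite comb_lin -fh.
move=> j; rewrite size_cat size_map; have [/fus //|usj] := ltnP j (size us).
move=> jlt; have {fvs} := fvs (j - size us)%N; rewrite /f' subnKC // => fvs.
rewrite -[f j](addKr (x *: h (j - size us)%N)) -scalerN; apply: smD.
  by apply: addml; exists (- h (j - size us)%N).
by apply/addmr/fvs; rewrite -(ltn_add2l (size us)) subnKC.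
Qed.

End Monomials.

(** * Values of forms over an infinite residue field *)

Section Nonvanishing.
Context {A : comNzRingType} (m : ideal A).
Hypotheses (noethA : noetherian A) (localA : local_ring m).
Hypothesis infinite_residue : infinite_set [set: quot m].

(** Modulo [m] a nonzero polynomial of degree at most [n] has at most [n] roots:
    split off the linear factors of the roots one at a time. *)
Lemma poly_nonzero (p : {poly A}) i : ~ m p`_i -> exists t, ~ m p.[t].
Proof.
have [t tinj] := residue_sequence infinite_residue.
suff main n (q : {poly A}) : (size q <= n)%N ->
    (forall K, exists2 k, (K <= k)%N & m q.[t k]) -> forall j, m q`_j.
  move=> npi; apply: contrapT => /forallNP mp; apply: npi; apply: (main _ _ (leqnn _)).
  by move=> K; exists K => //; apply: contrapT; exact: mp.
elim: n q => [|n IH] q qn qt j.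
  by rewrite nth_default ?(leq_trans qn) //; exact: sm0.
have [k0 _ qk0] := qt 0%N.
have /factor_theorem [g gE] : root (q - (q.[t k0])%:P) (t k0).
  by rewrite /root !hornerE subrr.
have qE : q = g * ('X - (t k0)%:P) + (q.[t k0])%:P by rewrite -gE subrK.
have gn : (size g <= n)%N.
  have [->|g0] := eqVneq g 0; first by rewrite size_poly0.
  have -> : size g = (size (g * ('X - (t k0)%:P))).-1.
    by rewrite size_Mmonic ?monicXsubC // size_XsubC addn2.
  rewrite -gE -subn1 leq_subLR add1n.
  apply: leq_trans (size_polyD _ _) _; rewrite geq_max qn size_polyN.
  exact: leq_trans (size_polyC_leq1 _) _.
have gm := IH g gn.
have {gm} gm : forall i, m g`_i.
  apply: gm => K; have [k Kk qk] := qt (maxn K k0.+1).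
  exists k; first by lia.
  have : m (g.[t k] * (t k - t k0)).
    have := smB qk qk0; rewrite {1}qE !hornerE.
    by rewrite addrK.
  have [_ pM] := max_prime noethA localA.
  by move=> /pM [] // /tinj kk0; lia.
rewrite qE coefD mulrBr coefB coefMX coefMC coefC.
apply: smD; last by case: ifP => // _; exact: sm0.
apply: smB; first by case: ifP => // _; exact: sm0.
by rewrite mulrC; exact: ideal_mull.
Qed.

Lemma form_horner (ls : seq A) n (f : nat -> A^o) :
  exists p : {poly A}, forall t, comb (mons (t :: ls) n) f = p.[t].
Proof.
elim: n f => [|n IH] f.
  by exists (f 0%N : A)%:P => t; rewrite mons0 /= scale1r addr0 hornerC.
have [p pE] := IH f; pose N := size (mons (0 :: ls) n).
exists ('X * p + (comb (mons ls n.+1) (fun j => f (N + j)%N) : A)%:P) => t.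
rewrite monsS comb_cat comb_map pE size_map !hornerE.
by rewrite (size_mons (ys := 0 :: ls)).
Qed.

(** As a function of its first coordinate the form is a polynomial in one
    variable. By induction on the number of variables, the other coordinates
    can be chosen so that one of its coefficients is a unit. *)
Lemma form_nonzero_step s n (f : nat -> A^o) j :
  (forall k (g : nat -> A^o) i, (i < size (mons (nseq s 0%R : seq A) k))%N ->
     ~ m (g i) -> exists2 ls, size ls = s & ~ m (comb (mons ls k) g)) ->
  (j < size (mons (nseq s.+1 0%R : seq A) n))%N -> ~ m (f j) ->
  exists (t : A) ls, [/\ size ls = s, ~ m t & ~ m (comb (mons (t :: ls) n) f)].
Proof.
move=> IHs.
suff main k (g : nat -> A^o) i :
    (i < size (mons (nseq s.+1 0%R : seq A) k))%N -> ~ m (g i) ->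
    exists ls (p : {poly A}) l, [/\ size ls = s,
      forall t, comb (mons (t :: ls) k) g = p.[t] & ~ m p`_l].
  move=> js fj; have [ls [p [k [lss pE pk]]]] := main n f j js fj.
  (* The factor ['X] forces the value [t] of the first coordinate to be a
     unit. *)
  have [|t] := @poly_nonzero ('X * p) k.+1; first by rewrite coefXM.
  rewrite !hornerE -pE => mt; exists t, ls; split=> // mt'; apply: mt.
    exact: ideal_mulr.
  exact: ideal_mull.
elim: k g i => [|k IHk] g i.
  rewrite mons0; case: i => // _ g0; exists (nseq s 0), (g 0%N : A)%:P, 0%N.
  split=> [|t|]; first by rewrite size_nseq.
    by rewrite mons0 /= scale1r addr0 hornerC.
  by rewrite coefC.
pose N := size (mons (0 :: nseq s 0 : seq A) k).
have combE ls p : size ls = s -> (forall t, comb (mons (t :: ls) k) g = p.[t]) ->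
    forall t, comb (mons (t :: ls) k.+1) g =
      ('X * p + (comb (mons ls k.+1) (fun j => g (N + j)%N) : A)%:P).[t].
  move=> lss pE t; rewrite monsS comb_cat comb_map pE size_map !hornerE.
  by rewrite (size_mons (ys := 0 :: nseq s 0)) //= lss size_nseq.
rewrite -[nseq s.+1 _]/((0 : A) :: nseq s 0) monsS size_cat size_map -/N => ilt gi.
have [iN|Ni] := ltnP i N.
  have [ls [p [l [lss pE pl]]]] := IHk g i iN gi.
  exists ls, ('X * p + (comb (mons ls k.+1) (fun j => g (N + j)%N) : A)%:P), l.+1.
  by split=> //; [exact: combE|rewrite coefD coefXM coefC addr0].
have [||ls lss gls] := IHs k.+1 (fun j => g (N + j)%N) (i - N)%N.
- by rewrite -(ltn_add2l N) subnKC.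
- by rewrite subnKC.
have [p pE] := form_horner ls k g.
exists ls, ('X * p + (comb (mons ls k.+1) (fun j => g (N + j)%N) : A)%:P), 0%N.
by split=> //; [exact: combE|rewrite coefD coefXM coefC add0r].
Qed.

Lemma form_nonzero_tail s n (f : nat -> A^o) j :
  (j < size (mons (nseq s 0%R : seq A) n))%N -> ~ m (f j) ->
  exists2 ls, size ls = s & ~ m (comb (mons ls n) f).
Proof.
elim: s n f j => [|s IHs] n f j js fj; last first.
  have [t [ls [lss _ fls]]] := form_nonzero_step IHs js fj.
  by exists (t :: ls); rewrite //= lss.
case: n js => //; case: j fj => // f0 _.
by exists [::]; rewrite //= scale1r addr0.
Qed.

Lemma form_nonzero s n (f : nat -> A^o) j :
  (j < size (mons (nseq s.+1 0%R : seq A) n))%N -> ~ m (f j) ->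
  exists (t : A) ls, [/\ size ls = s, ~ m t & ~ m (comb (mons (t :: ls) n) f)].
Proof. by apply: form_nonzero_step => k g i; exact: form_nonzero_tail. Qed.

End Nonvanishing.

(** Modulo the ideal [(zs)] of the differences [t y_i - x l_i], the points
    [t ys] and [x ls] agree, hence so do the monomials. *)
Lemma mons_congr {A : comNzRingType} (xs zs ys ls : seq A) x t n j :
  size ys = size ls -> x \in xs -> {subset ys <= xs} ->
  (forall i, (i < size ys)%N -> gen A^o zs (t * ys`_i - x * ls`_i)) ->
  (j < size (mons ys n.+1))%N ->
  lc zs (gen A^o (mons xs n))
    (t ^+ n.+1 * (mons ys n.+1)`_j - x ^+ n.+1 * (mons ls n.+1)`_j).
Proof.
move=> ysls xxs ysxs zsP.
pose Q k : ideal A := if k is l.+1 then lc zs (gen A^o (mons xs l)) else zerom.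
have QS k y a : y \in xs -> Q k a -> Q k.+1 (y * a).
  case: k => [|k] yxs /=; first by move=> ->; rewrite mulr0; exact: sm0.
  by move=> Qa; rewrite lc_monsS lc_lcC; exact: (lc_mem (V := A^o)).
have Qz k z : gen A^o zs z -> Q k.+1 (z * x ^+ k).
  by move=> zsz; apply: (gen_act (V := A^o) zsz); exact: exp_gen_mons.
suff main k l : (l < size (mons ys k))%N ->
    Q k (t ^+ k * (mons ys k)`_l - x ^+ k * (mons ls k)`_l).
  exact: (main n.+1 j).
elim: ys ls ysls ysxs zsP k l {j} => [|y ys IH] [|c ls] //= ysls ysxs zsP k.
  by case: k => [|k] l //=; case: l => // _; rewrite subrr; exact: sm0.
have [ysls'] := ysls.
elim: k => [|k IHk] l.
  by case: l => // _ /=; rewrite subrr; exact: sm0.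
rewrite size_cat size_map => lt; rewrite !nth_cat !size_map.
have sE : size (mons (c :: ls) k) = size (mons (y :: ys) k) by apply: size_mons.
rewrite -/(mons (y :: ys) k) -/(mons (c :: ls) k) in lt IHk *; rewrite sE.
case: ifP => lys; last first.
  apply: (IH ls ysls' _ _ k.+1).
  - by move=> z zys; apply: ysxs; rewrite inE zys orbT.
  - by move=> i iys; exact: (zsP i.+1).
  - by rewrite -(ltn_add2l (size (mons (y :: ys) k))) subnKC // leqNgt lys.
rewrite !(nth_map 0) ?sE //.
set u := (mons (y :: ys) k)`_l in IHk *; set v := (mons (c :: ls) k)`_l in IHk *.
have -> : t ^+ k.+1 * (y * u) - x ^+ k.+1 * (c * v) =
    t * (y * (t ^+ k * u - x ^+ k * v)) + v * ((t * y - x * c) * x ^+ k).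
  by rewrite !exprS; ring.
apply: smD; apply: ideal_mull; last by apply: Qz; exact: (zsP 0%N).
apply: QS; first by apply: ysxs; exact: mem_head.
by apply: IHk.
Qed.

(** * Growth of lengths *)

Lemma leq_exp_bin n d : (n ^ d <= d`! * 'C(n + d, d))%N.
Proof.
rewrite mulnC bin_ffact; elim: d => [|d IH] //.
by rewrite expnS addnS ffactnS /= leq_mul // ltnW // ltnS leq_addr.
Qed.

Lemma leq_ffact_exp n d : (n ^_ d <= n ^ d)%N.
Proof.
elim: d n => [|d IH] n //; rewrite ffactnS expnS leq_mul //.
apply: leq_trans (IH _) _; have [->|] := posnP d; first by rewrite !expn0.
by move=> d0; rewrite leq_exp2r // leq_pred.
Qed.

(** A polynomial in [n] of degree [s] is not bounded by one of degree
    [d < s]. *)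
Lemma bin_growth s d N c :
  (forall n, 'C(n + s, n) <= 'C((N * n.+1).-1 + d, (N * n.+1).-1) * c)%N ->
  (s <= d)%N.
Proof.
move=> le_bin; rewrite leqNgt; apply/negP => ds.
(* For [n >= d] the right-hand side is at most [c ((2 N + 1) n) ^ d], and the
   left-hand side is at least [n ^ (d + 1) / (d + 1)!]. *)
pose B := (d.+1`! * c * (2 * N + 1) ^ d)%N; pose n := (B + d).+1.
have := le_bin n; apply/negP; rewrite -ltnNge.
have lb : (n ^ d.+1 <= d.+1`! * 'C(n + s, n))%N.
  apply: leq_trans (leq_exp_bin _ _) _; rewrite leq_mul2l.
  apply/orP; right; rewrite -[in X in (X <= _)%N]bin_sub ?leq_addl // addnK.
  by apply: leq_bin2l; rewrite leq_add2l.
have ub : ('C((N * n.+1).-1 + d, (N * n.+1).-1) <= ((2 * N + 1) * n) ^ d)%N.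
  rewrite -bin_sub ?leq_addr // addKn.
  apply: leq_trans (_ : ((N * n.+1).-1 + d) ^ d <= _)%N.
    rewrite (leq_trans _ (leq_ffact_exp _ _)) // -bin_ffact.
    by rewrite leq_pmulr // fact_gt0.
  have [->|d0] := posnP d; first by rewrite !expn0.
  rewrite leq_exp2r //; rewrite /n; nia.
rewrite -(ltn_pmul2l (fact_gt0 d.+1)); apply: leq_trans lb.
apply: leq_ltn_trans (_ : d.+1`! * (((2 * N + 1) * n) ^ d * c) < _)%N.
  by rewrite leq_mul2l leq_mul2r ub !orbT.
have -> : (d.+1`! * (((2 * N + 1) * n) ^ d * c) = B * n ^ d)%N.
  by rewrite expnMn /B; ring.
by rewrite expnS ltn_pmul2r ?expn_gt0 // /n ltnS leq_addr.
Qed.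

Section Lengths.
Context {A : comNzRingType}.

Lemma bounded_length_lc (Q : ideal A) (us : seq A) (W : ideal A) c :
  (forall u a, u \in us -> Q a -> W (u * a)) -> bounded_length topmod Q c ->
  bounded_length (addm (gen A^o us) W) W (size us * c).
Proof.
move=> usQ bQ; elim: us usQ => [|u us IH] usQ.
  by apply: bounded_length_refl; apply: addm_min => // _ ->; exact: sm0.
rewrite mulSn addnC; apply: (bounded_length_add (X := addm (gen A^o us) W)).
- by move=> v; exact: addmr.
- by apply: addm_min => v; [move=> usv; apply/addml/addmr|exact: addmr].
- by apply: IH => u' a u'us; apply: usQ; rewrite inE u'us orbT.
apply: (bounded_length_line (v := (u : A^o))) bQ => [a Qa|].
  apply: addmr; rewrite -[a *: _]/((a : A) * u) mulrC.
  by apply: usQ => //; exact: mem_head.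
move=> _ [_ [w [[_ [l [[k _ ->] usl ->]]] Ww ->]]].
exists (k : A), (l + w); split; first by exists l, w.
by rewrite addrA; congr (_ + _ + _); exact: mulrC.
Qed.

(** [mons (0 :: ys) n] has as many entries as there are monomials of degree at
    most [n] in [ys], each contributing at most the colength of [(ys)]. *)
Lemma bounded_length_mons (ys : seq A) n c :
  bounded_length topmod (gen A^o ys) c ->
  bounded_length topmod (gen A^o (mons ys n.+1)) (size (mons (0 :: ys) n) * c).
Proof.
move=> bys; elim: n => [|n IH]; first by rewrite lc_monsS lc_mons0 mons0 mul1n.
rewrite monsS size_cat size_map mulnDl addnC.
have sub k : gen A^o (mons ys k.+1) `<=` gen A^o (mons ys k).
  by rewrite lc_monsS => v; exact: lc_subr.
apply: (bounded_length_add (X := gen A^o (mons ys n.+1))) IH => //.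
have := @bounded_length_lc (gen A^o ys) (mons ys n.+1) (gen A^o (mons ys n.+2)) c _ bys.
rewrite (_ : addm _ _ = gen A^o (mons ys n.+1)); last first.
  by apply: submodule_eqE; split; [exact: addm_min|move=> v; exact: addml].
apply=> u a uys ysa; rewrite gen_monsS; exact: (lc_mem (V := A^o)).
Qed.

Context (m : ideal A).
Hypotheses (noethA : noetherian A) (localA : local_ring m).

Lemma finite_colength (K : ideal A) :
  (forall a : A, m a -> exists n, K (a ^+ n)) -> exists c, bounded_length topmod K c.
Proof.
move=> mK; have [zs mE] := ideal_gen noethA m.
have [z zzs|N NK] := @mons_nilpotent _ K zs.
  by apply: mK; rewrite mE; exact: gen_mem.
exists (size (mons (0%R :: zs) N) * 1)%N.
apply: (@bounded_lengthS _ _ topmod (gen A^o (mons zs N.+1))) => //.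
  by apply: gen_min => u; apply: NK; exact: leqnSn.
by apply: bounded_length_mons; rewrite -mE; exact: bounded_max.
Qed.

Lemma ichain_indep (us : seq A) (U W : ideal A) :
  (forall u, u \in us -> U u) -> W `<=` U ->
  (forall f : nat -> A^o, W (comb us f) -> forall j, (j < size us)%N -> m (f j)) ->
  ichain U W (size us).
Proof.
elim: us W => [|u us IH] W usU WU indep; first exact: ichain0.
apply: (@ichain_bot _ _ _ _ (addm W (scal u topmod))).
- apply: addm_min => // _ [k _ ->]; apply: ideal_scaler; apply: usU; exact: mem_head.
- split=> [v|UW]; first exact: addml.
  apply: (max1 localA).
  apply: (indep (fun j => if j is _.+1 then 0 else 1) _ 0%N) => //=.
  rewrite (_ : comb us _ = 0) ?addr0; last first.
    by apply: (comb_sm (X := zerom)) => j _; rewrite /= scaler0.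
  by apply/UW/addmr; exists 1.
- apply: IH => [v vus||f [w [_ [Ww [k _ ->] fE]]] j jus].
  + by apply: usU; rewrite inE vus orbT.
  + apply: addm_min => // _ [k _ ->]; apply: ideal_scaler; apply: usU; exact: mem_head.
  + apply: (indep (fun i => if i is l.+1 then f l else - k) _ j.+1) => //=.
    by rewrite -[comb us (_ \o _)]/(comb us f) fE scalerN addrC addrK.
Qed.

Lemma ichain_mons (xs : seq A) n :
  (forall x, x \in xs -> m x) ->
  (forall k (f : nat -> A^o), mulmod m (gen A^o (mons xs k)) (comb (mons xs k) f) ->
     forall j, (j < size (mons xs k))%N -> m (f j)) ->
  ichain topmod (gen A^o (mons xs n.+1)) (size (mons (0 :: xs) n)).
Proof.
move=> xsm indep.
have block k : ichain (gen A^o (mons xs k)) (gen A^o (mons xs k.+1)) (size (mons xs k)).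
  apply: (@ichainS _ _ (gen A^o (mons xs k)) (mulmod m (gen A^o (mons xs k)))) => //.
    rewrite lc_monsS -mulmod_gen; apply: mulmod_min => a v xsa; apply: mulmod_mem.
    exact: gen_min xsa.
  apply: ichain_indep; [by move=> u; exact: gen_mem| |exact: indep].
  by apply: mulmod_min => a v _; exact: smZ.
elim: n => [|n IH]; first by have := block 0%N; rewrite lc_mons0 !mons0.
rewrite monsS size_cat size_map addnC; apply: ichain_add (block n.+1) IH => //.
by rewrite lc_monsS => v; exact: lc_subr.
Qed.

(** Comparison of lengths: with [s] elements whose monomials are independent
    modulo [m], the colength of the [n]th power of [(xs)] grows at least like
    [n ^ s], but at most like [n ^ d] if a power of [(ys)] lies in [(xs)]. *)
Lemma size_indep_mons (xs ys : seq A) c :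
  (forall x, x \in xs -> m x) ->
  (forall k (f : nat -> A^o), mulmod m (gen A^o (mons xs k)) (comb (mons xs k) f) ->
     forall j, (j < size (mons xs k))%N -> m (f j)) ->
  (forall y, y \in ys -> exists n, gen A^o xs (y ^+ n)) ->
  bounded_length topmod (gen A^o ys) c ->
  (size xs <= size ys)%N.
Proof.
move=> xsm indep ysxs bys; have [N NP] := mons_nilpotent ysxs.
have pow k : gen A^o (mons ys (N.+1 * k)) `<=` gen A^o (mons xs k).
  elim: k => [|k IH]; first by rewrite muln0 !lc_mons0.
  rewrite mulnS lc_monsD (lc_monsS xs); apply: lc_min => u v uys ysv.
  by apply: gen_act; [exact: (NP N.+1)|exact: IH].
apply: (@bin_growth _ _ N.+1 c) => n.
rewrite -!(size_mons_cons 0); apply: (bounded_length_mons bys).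
apply: ichainS (ichain_mons n xsm indep) => //.
by rewrite prednK ?muln_gt0 //; exact: pow.
Qed.

End Lengths.

(** * Reductions *)

Section Reductions.
Context {A : comNzRingType} (m : ideal A).
Hypotheses (noethA : noetherian A) (localA : local_ring m).
Hypothesis infinite_residue : infinite_set [set: quot m].

Lemma comb_congr (L : ideal A) (us vs : seq A) (a b : A) (f : nat -> A^o) :
  size us = size vs ->
  (forall j, (j < size us)%N -> L (a * us`_j - b * vs`_j)) ->
  L (a * comb us f - b * comb vs f).
Proof.
elim: us vs f => [|u us IH] [|v vs] f //= usvs abL.
  by rewrite !mulr0 subrr; exact: sm0.
have -> : a * (u *: f 0%N + comb us (f \o succn)) -
    b * (v *: f 0%N + comb vs (f \o succn)) =
    (f 0%N : A) * (a * u - b * v) + (a * comb us (f \o succn) - b * comb vs (f \o succn)).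
  by rewrite -[u *: f _]/(u * (f 0%N : A)) -[v *: f _]/(v * (f 0%N : A)); ring.
apply: smD; first by apply: ideal_mull; exact: (abL 0%N).
by apply: IH => [|j jus]; [case: usvs|exact: (abL j.+1)].
Qed.

(** Noether normalization in the fibre cone: given a relation modulo [m]
    between the monomials of degree [k + 1], move a point [(t, ls)] where the form
    does not vanish to the first coordinate axis. The form then becomes monic in
    [x] modulo [zs], so that [x ^ (k + 1)], and with it all monomials of this
    degree, lie in [(zs) (x :: xs) ^ k + m (x :: xs) ^ (k + 1)]. *)
Lemma reduction_of_relation x xs n (f : nat -> A^o) j :
  mulmod m (gen A^o (mons (x :: xs) n)) (comb (mons (x :: xs) n) f) ->
  (j < size (mons (x :: xs) n))%N -> ~ m (f j) ->
  exists zs k, [/\ size zs = size xs, gen A^o zs `<=` gen A^o (x :: xs) &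
    gen A^o (mons (x :: xs) k.+1) `<=` lc zs (gen A^o (mons (x :: xs) k))].
Proof.
case: n => [|k].
  rewrite mons0; case: j => // f0 _ []; move: f0.
  rewrite /= scale1r addr0; apply: mulmod_min => a v ma _.
  exact: ideal_scaler.
set us := mons (x :: xs) k.+1 => mf jus mfj.
have [||t [ls [lss mt mfl]]] := @form_nonzero _ _ noethA localA infinite_residue (size xs) k.+1 f j.
- by rewrite (size_mons (ys := x :: xs)) // size_nseq.
- exact: mfj.
pose zs := [seq t * p.1 - x * p.2 | p <- zip xs ls].
exists zs, k; split.
- by rewrite size_map size_zip lss minnn.
- apply: gen_min => _ /mapP [[y l] yl ->].
  have yxs : y \in xs.
    by rewrite -(unzip1_zip (s := xs) (t := ls)) ?lss //; exact: (map_f fst yl).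
  suff : gen A^o (x :: xs) (t * y - x * l) by [].
  apply: smB; first by apply: ideal_mull; apply: gen_mem; rewrite inE yxs orbT.
  by apply: ideal_mulr; apply: gen_mem; exact: mem_head.
have congr_us i : (i < size us)%N -> lc zs (gen A^o (mons (x :: xs) k))
    (t ^+ k.+1 * us`_i - x ^+ k.+1 * (mons (t :: ls) k.+1)`_i).
  move=> ius; apply: mons_congr => //; [by rewrite /= lss|exact: mem_head|].
  case=> [|l] /= lxs; first by rewrite mulrC subrr; exact: sm0.
  apply: gen_mem; apply/(nthP 0); exists l; rewrite ?size_map ?size_zip ?lss ?minnn //.
  by rewrite (nth_map (0, 0)) ?size_zip ?lss ?minnn // nth_zip ?lss.
pose X := addm (lc zs (gen A^o (mons (x :: xs) k))) (mulmod m (gen A^o us)).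
have xX : X (x ^+ k.+1).
  have [c cE] := unit_notin noethA localA mfl.
  rewrite -[x ^+ _]mulr1 -cE mulrCA; apply: ideal_mull.
  set F := comb (mons (t :: ls) k.+1) f.
  have -> : x ^+ k.+1 * F = t ^+ k.+1 * comb us f - (t ^+ k.+1 * comb us f - x ^+ k.+1 * F).
    by rewrite opprB addrC subrK.
  apply: smB; first by apply/ideal_mull/addmr.
  by apply: addml; apply: comb_congr => //; apply: size_mons; rewrite /= lss.
have tX u : X (t ^+ k.+1 * u) -> X u.
  have : ~ m (t ^+ k.+1) by move=> /(max_exp noethA localA).
  move=> /(unit_notin noethA localA) [c cE] Xu.
  by rewrite -[u]mul1r -cE -mulrA; exact: ideal_mull.
apply: (nakayama noethA localA (noetherian_ring_module noethA)).
apply: gen_min => u /(nthP 0) [i ius <-]; apply: tX.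
rewrite -[t ^+ k.+1 * _](subrK (x ^+ k.+1 * (mons (t :: ls) k.+1)`_i)).
apply: smD; last exact: ideal_mulr.
exact/addml/congr_us.
Qed.

Section MinimalReduction.
Variables (I J : ideal A) (xs : seq A).
Hypotheses (minJ : minimal_reduction I J) (redJ : reduces_from I J 1).
Hypothesis JE : J = gen A^o xs.

Lemma expid_reduction c k : (1 <= c)%N ->
  expid I (k + c) = lc (mons xs k) (expid I c).
Proof.
move=> c1; elim: k => [|k IH]; first by rewrite lc_mons0.
rewrite lc_monsS -IH -mulmod_gen -JE addSn.
have [le ge] := redJ (leq_trans c1 (leq_addl k c)).
by apply: submodule_eqE; split.
Qed.

(** The monomials in a shortest system of generators of a minimal reduction
    are independent modulo [m], for a relation would yield a smaller
    reduction. *)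
Lemma minimal_reduction_indep k (f : nat -> A^o) :
  (forall zs, J = gen A^o zs -> (size xs <= size zs)%N) ->
  mulmod m (gen A^o (mons xs k)) (comb (mons xs k) f) ->
  forall j, (j < size (mons xs k))%N -> m (f j).
Proof.
move=> min_xs mf j jus; apply: contrapT => mfj.
have [[JI _] minJ'] := minJ.
case: xs JE expid_reduction min_xs mf jus => [|x xs'] JE' expE min_xs mf jus.
  case: k jus mf => // jus; case: j jus mfj => // _ f0; rewrite mons0 /= scale1r addr0.
  by move=> mf; apply: f0; move: mf; apply: mulmod_min => a v ma _; exact: ideal_scaler.
have [zs [l [zss zsJ pow]]] := reduction_of_relation mf jus mfj.
have redzs : reduction I (gen A^o zs).
  split; first by apply: subset_trans zsJ _; rewrite -JE'.
  exists l.+1 => n ln; rewrite mulmod_gen; split.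
    rewrite -mulmod_gen; apply: mulmod_min => a v zsa; apply: mulmod_mem.
    by apply: JI; rewrite JE'; exact: zsJ.
  have nE : n = (l + (n - l))%N by lia.
  rewrite nE -addSn !expE; try lia.
  apply: lc_min => u v uin Iv.
  have := pow u (gen_mem uin).
  apply: (lc_min (X := colon _ v)) => z a zzs pa; rewrite colonE.
  rewrite -[z *: a]/(z * (a : A)) -scalerA; apply: lc_mem => //.
  exact: gen_act.
have : J = gen A^o zs.
  apply: submodule_eqE; split; last by rewrite JE'.
  by apply: minJ' => //; rewrite JE'.
by move=> /min_xs; rewrite zss /= ltnn.
Qed.

End MinimalReduction.

End Reductions.

(** * Regular sequences inside a minimal reduction *)

Section RegularGenerators.
Context {A : comNzRingType} (m : ideal A).
Hypotheses (noethA : noetherian A) (localA : local_ring m).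

Lemma gen_rcons (V : lmodType A) xs x : gen V (rcons xs x) = addz (gen V xs) x.
Proof.
rewrite -cats1 lc_cat addmC /addz /=; congr addm; apply: submodule_eqE; split.
  by apply: addm_min => // _ ->; exact: sm0.
by move=> v; exact: addml.
Qed.

Lemma seqmodE (V : lmodType A) xs : seqmod V xs = gen V xs.
Proof.
suff spanE : Defs.span [set a : A^o | a \in xs] = gen A^o xs.
  by rewrite /seqmod spanE mulmod_gen.
apply: submodule_eqE; split.
  by move=> a /(_ (gen A^o xs)); apply; split=> [|x xxs]; [exact: smP|exact: gen_mem].
by apply: gen_min => x xxs W [_]; apply.
Qed.

Lemma regular_sequence_regseq (V : lmodType A) ys :
  regular_sequence V ys -> regseq (zerom : submodule V) ys.
Proof.
move=> [regys _]; suff main zs xs : (forall k, (k < size zs)%N ->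
    regmod (gen V (xs ++ take k zs)) zs`_k) -> regseq (gen V xs) zs.
  by apply: (main ys [::]) => k ks v; rewrite -!seqmodE; exact: regys.
elim: zs xs => [//|z zs IH] xs regz; split; first by have := regz 0%N isT; rewrite cats0.
rewrite -gen_rcons; apply: IH => k kzs.
by rewrite cat_rcons; exact: (regz k.+1).
Qed.

Lemma chain_sup_unique (V : lmodType A) (P : submodule V -> Prop) a b :
  chain_sup P a -> chain_sup P b -> a = b.
Proof. by move=> [ca ba] [cb bb]; apply/eqP; rewrite eqn_leq ba // bb. Qed.

Lemma cm_regseq (V : lmodType A) d :
  cohen_macaulay m V -> module_dim V d ->
  exists ys, [/\ size ys = d, forall y, y \in ys -> m y & regseq (zerom : submodule V) ys].
Proof.
move=> [t [[[ys [yst ysm regys]] _] dimt]] dimd.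
exists ys; split=> //; first by rewrite yst; exact: chain_sup_unique dimt dimd.
exact: regular_sequence_regseq.
Qed.

Lemma module_dim_ring d : krull_dim A d -> module_dim A^o d.
Proof.
have ann (P : ideal A) : annihilator A^o `<=` P.
  by move=> a /(_ 1); rewrite -[a *: 1]/(a * 1) mulr1 => ->; exact: sm0.
move=> [[c [cP cS]] bd]; split.
  by exists c; split=> // i /cP.
by move=> k [c' [c'P c'S]]; apply: bd; exists c'; split=> // i /c'P [].
Qed.

Section Choice.
Hypothesis infinite_residue : infinite_set [set: quot m].
Variables (M : lmodType A) (J : ideal A) (d : nat).
Hypothesis noethM : noetherian_module M.
Hypotheses (Jm : J `<=` m) (mJ : forall a : A, m a -> exists n, J (a ^+ n)).
Hypothesis boundJ : bounded_length J (mulmod m J) d.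

(** A regular sequence of length [d] in [m], on [A] and on [M], is exchanged
    element by element for generic elements of [J], which can be kept linearly
    independent modulo [mJ]. *)
Lemma regular_elements_exist k :
  (k <= d)%N ->
  forall ys ys' : seq A,
  size ys = d -> (forall y, y \in ys -> m y) -> regseq (zerom : submodule A^o) ys ->
  size ys' = d -> (forall y, y \in ys' -> m y) -> regseq (zerom : submodule M) ys' ->
  exists xs ys ys' : seq A, [/\ size xs = k, forall x, x \in xs -> J x,
    revregular A^o xs, revregular M xs &
    [/\ size ys = (d - k)%N, forall y, y \in ys -> m y, regseq (gen A^o xs) ys &
    [/\ size ys' = (d - k)%N, forall y, y \in ys' -> m y, regseq (gen M xs) ys' &
    ichain (addm (gen A^o xs) (mulmod m J)) (mulmod m J) k]]].
Proof.
move=> kd ys0 ys0' sys0 mys0 regys0 sys0' mys0' regys0'.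
elim: k kd => [|k IH] kd.
  exists [::], ys0, ys0'; split=> //; split=> //; first by rewrite subn0.
  split=> //; first by rewrite subn0.
  by apply: ichain0 => v; exact: addmr.
have [xs [ys [ys' [xsk xsJ regA regM [sys mys regys [sys' mys' regys' chain]]]]]] := IH (ltnW kd).
have JnX : ~ (J `<=` addm (gen A^o xs) (mulmod m J)).
  move=> /(nakayama noethA localA (noetherian_ring_module noethA)) Jxs.
  case: ys sys mys regys => [|y ys] /= sys mys; first by lia.
  move=> [yreg _]; have [n /Jxs Jy] := mJ (mys _ (mem_head _ _)).
  apply: (max1 localA); apply: Jm; apply: (gen_min xsJ).
  apply: (regmod_exp (n := n) yreg); rewrite -[_ *: _]/(y ^+ n * 1).
  by rewrite mulr1.
have [z Jz [nz [zA zM]]] : exists2 z, J z &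
    ~ addm (gen A^o xs) (mulmod m J) z /\
    (reg_all (gen A^o xs) ys z /\ reg_all (gen M xs) ys' z).
  apply: (generic_exists noethA localA infinite_residue).
  apply: genericI; first exact: generic_notin.
  apply: genericI.
    apply: (generic_reg_all noethA (noetherian_ring_module noethA)) regys.
    by move=> y /mys /mJ.
  by apply: (generic_reg_all noethA noethM) regys' => y /mys' /mJ.
move: sys mys regys zA; case/lastP: ys => [|ys y] /=; first by lia.
rewrite size_rcons => sys mys regys zA.
move: sys' mys' regys' zM; case/lastP: ys' => [|ys' y'] /=; first by lia.
rewrite size_rcons => sys' mys' regys' zM.
exists (z :: xs), ys, ys'; split.
- by rewrite /= xsk.
- by move=> x; rewrite inE => /predU1P [->|/xsJ].
- by split=> //; case: ys zA {sys mys regys} => [|? ?] [].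
- by split=> //; case: ys' zM {sys' mys' regys'} => [|? ?] [].
split.
- by lia.
- by move=> x xys; apply: mys; rewrite mem_rcons inE xys orbT.
- exact: regseq_exchange regys zA.
split.
- by lia.
- by move=> x xys; apply: mys'; rewrite mem_rcons inE xys orbT.
- exact: regseq_exchange regys' zM.
apply: ichain_top chain; first by move=> v; exact: addmr.
split=> [|sub]; first by rewrite /= -addmA => v; exact: addmr.
by apply/nz/sub/addml/gen_mem/mem_head.
Qed.

Lemma regular_generators :
  (exists ys, [/\ size ys = d, forall y, y \in ys -> m y & regseq (zerom : submodule A^o) ys]) ->
  (exists ys, [/\ size ys = d, forall y, y \in ys -> m y & regseq (zerom : submodule M) ys]) ->
  exists xs : seq A, [/\ size xs = d, J = gen A^o xs, revregular A^o xs & revregular M xs].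
Proof.
move=> [ys [sys mys regys]] [ys' [sys' mys' regys']].
have [xs [_ [_ [xsd xsJ regA regM [_ _ _ [_ _ _ chain]]]]]] :=
  regular_elements_exist (leqnn d) sys mys regys sys' mys' regys'.
exists xs; split=> //; apply: submodule_eqE; split; last exact: gen_min.
apply: (nakayama noethA localA (noetherian_ring_module noethA)); apply: contrapT => nJ.
suff /boundJ : ichain J (mulmod m J) d.+1 by rewrite ltnn.
apply: ichain_top chain; first by move=> v; exact: addmr.
split=> //; apply: addm_min; first exact: gen_min.
by apply: mulmod_min => a v _; exact: smZ.
Qed.

End Choice.

(** The growth of the colengths of the powers of [J] bounds the number of
    generators of [J] by [d], and the exchange of regular sequences provides [d]
    elements of [J] that are independent modulo [mJ]. *)
Lemma minimal_reduction_regular (M : lmodType A) (I J : ideal A) d :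
  infinite_set [set: quot m] ->
  krull_dim A d -> cohen_macaulay m A^o ->
  finitely_generated [set: M] -> maximal_cohen_macaulay m M ->
  primary_to m I -> minimal_reduction I J -> reduces_from I J 1 ->
  exists xs : seq A, [/\ size xs = d, J = gen A^o xs, revregular A^o xs & revregular M xs].
Proof.
move=> infm dimA cmA fgM [cmM [t [dimM dimt]]] [[I1 _] [radI Irad]] minJ redJ.
have dt : t = d := chain_sup_unique dimt dimA; rewrite {}dt {dimt t} in dimM.
have [ys [sys mys regys]] := cm_regseq cmA (module_dim_ring dimA).
have radys := regseq_radical noethA localA dimA sys mys regys.
have [[JI _] _] := minJ.
have Jm : J `<=` m by apply: subset_trans JI _; exact: proper_sub_max.
have IJ : forall a : A, I a -> J (a * a).
  move=> a Ia; have [_ IIJ] := redJ 1%N (leqnn _).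
  suff : mulmod J (expid I 1) (a * a).
    by apply: mulmod_min => b v Jb _; exact: ideal_scaler.
  apply: IIJ; rewrite -[a * a]/(a *: (a : A^o)).
  apply: mulmod_mem => //; rewrite -[a]mulr1 -[a * 1]/(a *: (1 : A^o)).
  exact: mulmod_mem.
have mJ a : m a -> exists n, J (a ^+ n).
  by move=> /Irad [n /IJ Jn]; exists (n + n)%N; rewrite exprD.
have [xs [JE min_xs]] : exists xs, J = gen A^o xs /\
    forall zs, J = gen A^o zs -> (size xs <= size zs)%N.
  pose P n := `[< exists2 xs, J = gen A^o xs & size xs = n >].
  have exP : exists n, P n.
    by have [xs JE] := ideal_gen noethA J; exists (size xs); apply/asboolP; exists xs.
  have [n /asboolP [xs JE <-] minn] := ex_minnP exP.
  by exists xs; split=> // zs zsE; apply: minn; apply/asboolP; exists zs.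
have sxs : (size xs <= d)%N.
  have [c bc] := finite_colength noethA localA radys.
  rewrite -sys; apply: (size_indep_mons localA _ _ _ bc).
  - by move=> x xxs; apply: Jm; rewrite JE; exact: gen_mem.
  - by move=> k f; exact: (minimal_reduction_indep noethA localA infm minJ redJ JE).
  - by move=> y /mys /mJ; rewrite JE.
apply: (regular_generators infm (noetherian_fg noethA fgM) Jm mJ).
- apply: (@bounded_lengthS _ _ (addm (gen A^o xs) (mulmod m J)) (mulmod m J)) => //.
    by rewrite {1}JE => v; exact: addml.
  move=> k /(@bounded_length_lc _ m xs (mulmod m J) 1 _ (bounded_max noethA localA)) kle.
  apply: leq_trans (kle _) _; last by rewrite muln1.
  move=> u a uxs ma; rewrite mulrC; apply: (mulmod_mem (V := A^o)) => //.
  by rewrite JE; exact: gen_mem.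
- by exists ys.
- exact: cm_regseq cmM dimM.
Qed.

End RegularGenerators.

(** * Vectors over a ring *)

Section Vectors.
Context {A : comNzRingType}.
Implicit Types K : ideal A.

Lemma is_submodule_vec K n : is_submodule (fun u : {ffun 'I_n -> A^o} => forall k, K (u k)).
Proof.
split=> [k|a u v Ku Kv k]; first by rewrite ffunE; exact: sm0.
by rewrite !ffunE; exact: smZD.
Qed.
Definition vec K n : submodule {ffun 'I_n -> A^o} := Submodule (is_submodule_vec K n).

Lemma vecS K K' n : K `<=` K' -> vec K n `<=` vec K' n.
Proof. by move=> KK' u Ku k; apply: KK'; exact: Ku. Qed.

Lemma vec_top n : vec topmod n = topmod.
Proof. exact: submodule_ext. Qed.

Lemma comb_ffunE n us (f : nat -> {ffun 'I_n -> A^o}) k :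
  (comb us f) k = comb us (fun j => f j k).
Proof. by elim: us f => [|u us IH] f /=; rewrite !ffunE ?IH. Qed.

Lemma vec_lc us K n : vec (lc us K) n = lc us (vec K n).
Proof.
apply: submodule_eqE; split=> [u Ku|]; last first.
  by apply: lc_min => u w uus Kw k; rewrite ffunE; exact: lc_mem.
have /choice [f fP] k : exists f, (forall j, K (f j)) /\ u k = comb us f.
  by have /lcP [f] := Ku k; exists f.
apply/lcP; exists (fun j => [ffun k => f k j]).
  by move=> j k; rewrite ffunE; have [] := fP k.
apply/ffunP => k; rewrite comb_ffunE; have [_ ->] := fP k.
by apply: eq_comb => j _; rewrite ffunE.
Qed.

Lemma vec_comb_indep us K n (f : nat -> {ffun 'I_n -> A^o}) :
  (forall g : nat -> A^o, comb us g = 0 -> forall j, (j < size us)%N -> K (g j)) ->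
  comb us f = 0 -> forall j, (j < size us)%N -> vec K n (f j).
Proof.
move=> indep f0 j jus k; apply: (indep (fun j => f j k)) => //.
by rewrite -comb_ffunE f0 ffunE.
Qed.

Lemma vec_gen_lc us n u : vec (gen A^o us) n u ->
  exists f : nat -> {ffun 'I_n -> A^o}, u = comb us f.
Proof. by rewrite vec_lc => /lcP [f _ ->]; exists f. Qed.

(** The coordinates are freed from [K] one at a time. *)
Lemma vec_bounded K n c : bounded_length topmod K c ->
  bounded_length topmod (vec K n) (n * c).
Proof.
move=> bK.
have part_sub l : is_submodule
    (fun u : {ffun 'I_n -> A^o} => forall k : 'I_n, (l <= k)%N -> K (u k)).
  split=> [k _|a u v Ku Kv k lk]; first by rewrite ffunE; exact: sm0.
  by rewrite !ffunE; apply: smZD; [exact: Ku|exact: Kv].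
suff part l : (l <= n)%N -> bounded_length (Submodule (part_sub l)) (vec K n) (l * c).
  by have := part n (leqnn n); apply: bounded_lengthS => // u _ k; rewrite leqNgt ltn_ord.
elim: l => [|l IH] ln; first by apply: bounded_length_refl => u Ku k; exact: Ku.
rewrite mulSn addnC.
apply: (bounded_length_add (X := Submodule (part_sub l))) (IH (ltnW ln)) _.
- by move=> u Ku k _; exact: Ku.
- by move=> u Ku k lk; apply: Ku; exact: ltnW.
pose k0 := Ordinal ln.
pose e : {ffun 'I_n -> A^o} := [ffun k => (k == k0)%:R].
apply: (bounded_length_line (v := e)) bK => [a Ka k _|u Ku].
  rewrite !ffunE; case: eqP => _; first by rewrite -[a *: _]/((a : A) * 1) mulr1.
  by rewrite -[_ *: _]/((a : A) * 0) mulr0; exact: sm0.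
exists (u k0 : A), (u - (u k0 : A) *: e); split; last by rewrite addrC subrK.
move=> k lk; rewrite !ffunE.
have [->|kk0] := eqVneq k k0.
  by rewrite -[_ *: _]/((u k0 : A) * 1) mulr1 subrr; exact: sm0.
rewrite -[_ *: _]/((u k0 : A) * 0) mulr0 subr0; apply: Ku.
by rewrite ltn_neqAle lk andbT; apply: contra kk0 => /eqP lk0; apply/eqP/val_inj.
Qed.

Section Matrices.
Context {p q : nat} (D : 'M[A]_(p, q)).
Local Notation Dm := (mxmap (N := A^o) D).

Lemma mxmapD u v : Dm (u + v) = Dm u + Dm v.
Proof. by rewrite -[u]scale1r mxmapZD !scale1r. Qed.

Lemma mxmapZ a u : Dm (a *: u) = a *: Dm u.
Proof. by rewrite -[a *: u]addr0 mxmapZD mxmap0 addr0. Qed.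

Lemma mxmapB u v : Dm (u - v) = Dm u - Dm v.
Proof. by rewrite mxmapD -scaleN1r mxmapZ scaleN1r. Qed.

Lemma mxmap_comb us f : Dm (comb us f) = comb us (fun j => Dm (f j)).
Proof.
elim: us f => [|u us IH] f /=; first exact: mxmap0.
by rewrite mxmapD mxmapZ IH.
Qed.

Lemma mxmap_vec K u : vec K p u -> vec K q (Dm u).
Proof. by move=> Ku k; rewrite ffunE; apply: sm_sum => j; apply: smZ; exact: Ku. Qed.

End Matrices.

End Vectors.

(** * Homology with coefficients in a residue ring *)

Section ResidueHomology.
Context {A : comNzRingType} (F : free_complex A).

Lemma is_submodule_rcycles (K : ideal A) i :
  is_submodule (fun u : {ffun 'I_(fc_rank F i.+1) -> A^o} =>
    vec K _ (mxmap (N := A^o) (fc_diff F i) u)).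
Proof.
split=> [|a u v Ku Kv]; first by rewrite mxmap0; exact: sm0.
by rewrite mxmapZD; exact: smZD.
Qed.

(** The preimages, in the free module of rank [fc_rank F i.+1], of the cycles
    and of the boundaries of [F] with coefficients in [A / K]. *)
Definition rcycles K i := Submodule (is_submodule_rcycles K i).
Definition rboundaries (K : ideal A) i := addm (boundaries F A^o i) (vec K _).

Section Quotient.
Variables (K : ideal A).

Lemma quot_pi0 (V : lmodType A) (W : submodule V) : quot_pi W 0 = 0.
Proof. by apply: (addrI (quot_pi W 0)); rewrite -quot_piD !addr0. Qed.

Lemma quot_piZ (V : lmodType A) (W : submodule V) a v :
  a *: quot_pi W v = quot_pi W (a *: v).
Proof. exact: quot_scale_pi. Qed.

Lemma quot_pi_eq0 (V : lmodType A) (W : submodule V) v : quot_pi W v = 0 <-> W v.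
Proof. by rewrite -(quot_pi0 W) quot_piP subr0. Qed.

Definition vec_pi n (u : {ffun 'I_n -> A^o}) : {ffun 'I_n -> quot K} :=
  [ffun k => quot_pi K (u k)].

Lemma vec_piP n (u v : {ffun 'I_n -> A^o}) : vec_pi u = vec_pi v <-> vec K n (u - v).
Proof.
split=> [/ffunP uv k|Kuv].
  by have := uv k; rewrite !ffunE => /quot_piP.
by apply/ffunP => k; rewrite !ffunE; apply/quot_piP; have := Kuv k; rewrite !ffunE.
Qed.

Lemma vec_piZD n a (u v : {ffun 'I_n -> A^o}) :
  vec_pi (a *: u + v) = a *: vec_pi u + vec_pi v.
Proof. by apply/ffunP => k; rewrite !ffunE quot_piD quot_piZ. Qed.

Lemma vec_pi0 n : vec_pi (0 : {ffun 'I_n -> A^o}) = 0.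
Proof. by apply/ffunP => k; rewrite !ffunE quot_pi0. Qed.

Lemma vec_pi_surj n (w : {ffun 'I_n -> quot K}) : exists u, w = vec_pi u.
Proof.
have /choice [f fP] k : exists x, w k = quot_pi K x by exact: quot_pi_surj.
by exists [ffun k => f k]; apply/ffunP => k; rewrite !ffunE.
Qed.

Lemma mxmap_pi p q (D : 'M[A]_(p, q)) u :
  mxmap D (vec_pi u) = vec_pi (mxmap (N := A^o) D u).
Proof.
apply/ffunP => k; rewrite !ffunE (big_morph (quot_pi K) (@quot_piD _ _ K) (quot_pi0 K)).
by apply: eq_bigr => j _; rewrite ffunE quot_piZ.
Qed.

Lemma has_lengthE (V : lmodType A) l : has_length V l <-> ilength (@topmod _ V) zerom l.
Proof.
have chE k : has_chain (fun _ : submodule V => True) k <-> ichain (@topmod _ V) zerom k.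
  split=> -[c [cP cS]]; exists c; split=> // i _; split=> // v ->; exact: sm0.
split=> -[/chE cl bl]; split=> //; first by move=> k /chE /bl.
by move=> k /chE /bl.
Qed.

Hypothesis complexF : forall i v,
  mxmap (N := A^o) (fc_diff F i) (mxmap (fc_diff F i.+1) v) = 0.

Lemma rboundaries_sub i : rboundaries K i.+1 `<=` rcycles K i.
Proof.
apply: addm_min => [_ [v <-]|u Ku]; last exact: mxmap_vec.
by have -> : forall u, rcycles K i u = vec K _ (mxmap (N := A^o) (fc_diff F i) u) by [];
   rewrite complexF; exact: sm0.
Qed.

Lemma homology_length i l :
  ilength (rcycles K i) (rboundaries K i.+1) l -> has_length (homology F (quot K) i.+1) l.
Proof.
move=> len; apply/has_lengthE.
pose C : submodule {ffun 'I_(fc_rank F i.+1) -> quot K} := cycles F (quot K) i.+1.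
pose W : submodule (submod_type C) :=
  Submodule (submodule_within C (boundaries F (quot K) i.+1)).
pose R u (h : homology F (quot K) i.+1) :=
  exists w : submod_type C, h = quot_pi W w /\ val w = vec_pi u.
have cyc u : C (vec_pi u) <-> rcycles K i u.
  split=> [|Zu].
    move=> Cu; have : mxmap (N := quot K) (fc_diff F i) (vec_pi u) = 0 by exact: Cu.
    by rewrite mxmap_pi -(vec_pi0 _) => /vec_piP; rewrite subr0.
  suff : mxmap (N := quot K) (fc_diff F i) (vec_pi u) = 0 by [].
  by rewrite mxmap_pi -(vec_pi0 _); apply/vec_piP; rewrite subr0.
have lift u : C (vec_pi u) -> exists w : submod_type C, val w = vec_pi u.
  by move=> /smpredE Cu; exists (exist (fun v => v \in smpred C) _ Cu).
have lift_bnd u : rboundaries K i.+1 u -> exists2 w : submod_type C, W w & val w = vec_pi u.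
  move=> Bu; have [w wE] := lift u (proj2 (cyc u) (rboundaries_sub Bu)).
  exists w => //; suff : boundaries F (quot K) i.+1 (val w) by [].
  have [_ [y [[v <-] Ky uE]]] := Bu; exists (vec_pi v); rewrite wE mxmap_pi.
  by apply/vec_piP; rewrite uE opprD addrA subrr sub0r -scaleN1r; exact: smZ.
apply: (ilength_corr (R := R)) len.
- move=> a u v _ _ [w [-> wE]] [w' [-> w'E]]; exists (a *: w + w'); split.
    by rewrite quot_piD quot_piZ.
  by rewrite linearP /= wE w'E vec_piZD.
- by exists 0; rewrite quot_pi0 vec_pi0 raddf0.
- exact: rboundaries_sub.
- by [].
- move=> u h [w [_ wE]]; split=> //; apply/cyc; rewrite -wE.
  by apply/smpredE; exact: (valP w).
- by move=> u /cyc /lift [w wE]; exists (quot_pi W w), w.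
- move=> h _; have [w ->] := quot_pi_surj h; have [u uE] := vec_pi_surj (val w).
  by exists u, w.
- move=> u /lift_bnd [w Ww wE]; exists 0 => //; exists w; split=> //.
  by apply/esym/quot_pi_eq0.
- by move=> _ ->; exists 0; [exact: sm0|exists 0; rewrite quot_pi0 vec_pi0 raddf0].
- move=> u [w [/esym/quot_pi_eq0 Ww wE]].
  have [v' v'E] : boundaries F (quot K) i.+1 (val w) by exact: Ww.
  have [v vE] := vec_pi_surj v'; move: v'E; rewrite vE mxmap_pi wE => /esym/vec_piP Ku.
  exists (mxmap (N := A^o) (fc_diff F i.+1) v), (u - mxmap (N := A^o) (fc_diff F i.+1) v).
  by split=> //; [exists v|rewrite addrC subrK].
- move=> h [w [-> wE]]; apply/quot_pi_eq0.
  suff -> : w = 0 by exact: sm0.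
  by apply: val_inj; rewrite wE vec_pi0 raddf0.
Qed.

End Quotient.

End ResidueHomology.

(** * The Tor modules of the powers of an ideal *)

Section TorPowers.
Context {A : comNzRingType} (M : lmodType A) (F : free_complex A).
Hypothesis resF : free_resolution M F.

Local Notation diff i := (mxmap (N := A^o) (fc_diff F i)).

Lemma resolution_complex i v : diff i (diff i.+1 v) = 0.
Proof. by have [exF _] := resF; have [_ sub] := exF i; apply: sub; exists v. Qed.

Lemma resolution_exact i u : diff i u = 0 -> exists v, diff i.+1 v = u.
Proof. by have [exF _] := resF; have [sub _] := exF i; exact: sub. Qed.

(** [Tor_(i + 1)] of [M] and [A / K] vanishes. *)
Definition tor_zero (K : ideal A) i : Prop := rcycles F K i `<=` rboundaries F K i.+1.

(** The long exact sequence for multiplication by [x], which is injective on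
    [A / (xs)] and on [M / (xs)M], gives the induction over the sequence. *)
Lemma tor_zero_gen xs i : revregular A^o xs -> revregular M xs ->
  tor_zero (gen A^o xs) i.
Proof.
have [_ [e [surj_e ker_e]]] := resF.
pose aug (a : {ffun 'I_(fc_rank F 0) -> A^o}) := \sum_j (a j : A) *: e j.
have augZD a u v : aug (a *: u + v) = a *: aug u + aug v.
  rewrite /aug scaler_sumr -big_split; apply: eq_bigr => j _ /=.
  by rewrite !ffunE scalerDl scalerA.
have aug0 : aug 0 = 0 by rewrite /aug big1 // => j _; rewrite ffunE scale0r.
have aug_comb us f : aug (comb us f) = comb us (fun j => aug (f j)).
  elim: us f => [|u us IH] f /=; first exact: aug0.
  by rewrite augZD IH.
have aug_vec us u : vec (gen A^o us) _ u -> gen M us (aug u).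
  by move=> /vec_gen_lc [f ->]; rewrite aug_comb; exact: comb_lc.
(* Exactness at the end of the augmented resolution plays the part of
   [Tor_0(M, A / (us)) = M / (us)M]. *)
have aug_zero us z : gen M us (aug z) -> rboundaries F (gen A^o us) 0 z.
  move=> /lcP [f _ zE].
  have /choice [g gP] j : exists a, f j = aug a by exact: surj_e.
  have /ker_e Bz : aug (z - comb us g) = 0.
    rewrite -scaleN1r addrC augZD scaleN1r zE aug_comb addrC.
    by rewrite (eq_comb (g := fun j => aug (g j))) ?subrr // => j _; rewrite gP.
  exists (z - comb us g), (comb us g); split=> //; last by rewrite subrK.
  by rewrite vec_lc; apply: comb_lc => j _; rewrite vec_top.
elim: xs i => [|x xs IH] i.
  move=> _ _ u Zu; apply: addml; apply: resolution_exact.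
  by apply/ffunP => k; rewrite [RHS]ffunE; exact: Zu.
move=> [xsA xA] [xsM xM] u Zu.
have : lc (x :: xs) (vec topmod (fc_rank F i)) (diff i u).
  by rewrite -vec_lc; exact: Zu.
move=> [_ [w [[z _ ->] xsw duE]]].
have {}xsw : vec (gen A^o xs) _ w by rewrite vec_lc.
have [y [w' [[z' yE] xsw' zE]]] : rboundaries F (gen A^o xs) i z.
  case: i u Zu z w duE xsw => [|i] u Zu z w duE xsw.
    apply/aug_zero/xM; have : aug (diff 0 u) = 0 by apply/ker_e; exists u.
    rewrite duE augZD => /eqP; rewrite addr_eq0 => /eqP ->.
    by rewrite -scaleN1r; apply: smZ; exact: aug_vec.
  apply: (IH i xsA xsM) => k; apply: xA.
  have /ffunP /(_ k) : x *: diff i z = - diff i w.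
    apply/eqP; rewrite -addr_eq0 -mxmapZD -duE; apply/eqP.
    exact: resolution_complex.
  rewrite [in LHS]ffunE => ->; rewrite -scaleN1r ffunE; apply: smZ.
  exact: mxmap_vec.
have [_ [w'' [[v <-] xsw'' uE]]] : rboundaries F (gen A^o xs) i.+1 (u - x *: z').
  apply: IH => //; suff : vec (gen A^o xs) _ (diff i (u - x *: z')) by [].
  rewrite mxmapB mxmapZ duE zE -yE scalerDr addrAC [X in X - _]addrC addrK.
  by apply: smD => //; exact: smZ.
exists (diff i.+1 v), (w'' + x *: z'); split; first by exists v.
  apply: smD; first by move=> k; apply: addmr; exact: xsw''.
  by move=> k; rewrite ffunE; apply: addml; exists (z' k).
by rewrite addrA -uE subrK.
Qed.

Lemma lc_rboundaries us K i :
  lc us (rboundaries F K i) `<=` rboundaries F (lc us K) i.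
Proof.
apply: lc_min => x _ xus [_ [w [[v <-] Kw ->]]]; rewrite scalerDr; apply: smD.
  by apply: addml; exists (x *: v); exact: mxmapZ.
by apply: addmr; rewrite vec_lc; exact: lc_mem.
Qed.

Section Independent.
Variables (us : seq A) (J K : ideal A).
Hypotheses (JK : J `<=` K)
  (indep : forall f : nat -> A^o, comb us f = 0 -> forall j, (j < size us)%N -> J (f j)).

Lemma rcycles_comb i f : rcycles F (lc us K) i (comb us f) ->
  forall j, (j < size us)%N -> rcycles F K i (f j).
Proof.
move=> Zf; apply: (comb_in_lc (f := fun j => diff i (f j))
  (fun g => vec_comb_indep indep (f := g))); first exact: vecS.
by rewrite -vec_lc -mxmap_comb; exact: Zf.
Qed.

(** As [Tor(M, A / (us))] vanishes, a cycle modulo [(us)K] is a boundary up to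
    a combination of the [us], whose coefficients are then cycles modulo
    [K]. *)
Lemma rcycles_decomp i : tor_zero (gen A^o us) i ->
  rcycles F (lc us K) i `<=` addm (boundaries F A^o i.+1) (lc us (rcycles F K i)).
Proof.
move=> tor_us u Zu.
have [k|_ [w [[v <-] usw uE]]] := tor_us u.
  by have := Zu k; exact: lcS.
have [f wE] := vec_gen_lc usw.
exists (diff i.+1 v), w; split=> //; first by exists v.
rewrite wE; apply: comb_lc; apply: rcycles_comb.
suff -> : comb us f = u - diff i.+1 v.
  apply: smB => // k; rewrite resolution_complex ffunE; exact: sm0.
by rewrite uE -wE addrAC subrr add0r.
Qed.

(** The cycles modulo [(us)K] are, modulo boundaries, a direct sum of copies
    of the homology modulo [K], one for each element of [us]. *)
Lemma ilength_rcycles i l :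
  tor_zero (gen A^o us) i -> tor_zero (gen A^o us) i.+1 ->
  ilength (rcycles F K i) (rboundaries F K i.+1) l ->
  ilength (rcycles F (lc us K) i) (rboundaries F (lc us K) i.+1) (size us * l).
Proof.
move=> tor_i tor_iS len.
have BZ L : rboundaries F L i.+1 `<=` rcycles F L i.
  exact: rboundaries_sub resolution_complex _.
have -> : rcycles F (lc us K) i =
    addm (lc us (rcycles F K i)) (rboundaries F (lc us K) i.+1).
  apply: submodule_eqE; split.
    move=> u /(rcycles_decomp tor_i) [b [z [Bb Zz ->]]]; apply: smD.
      exact/addmr/addml.
    exact: addml.
  apply: addm_min; last exact: BZ.
  by apply: lc_min => x z xus Zz k; rewrite mxmapZ ffunE; exact: lc_mem.
apply: ilength_lc len; first exact: BZ.
  by move=> x b xus Bb; apply: lc_rboundaries; exact: lc_mem.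
move=> f Zf [_ [w [[v <-] Kw fE]]] j jus.
have Zv : rcycles F (gen A^o us) i.+1 v.
  suff : vec (gen A^o us) _ (diff i.+1 v) by [].
  have -> : diff i.+1 v = comb us f - w by rewrite fE addrK.
  apply: smB; first by rewrite vec_lc vec_top; exact: comb_lc.
  by move=> k; have := Kw k; exact: lcS.
have [_ [y [[v' <-] usy vE]]] := tor_iS v Zv.
have [g yE] := vec_gen_lc usy.
rewrite -[f j](subrK (diff i.+1 (g j))); apply: smD; last first.
  by apply: addml; exists (g j).
apply: addmr; move: j jus; apply: (comb_in_lc
  (f := fun j => f j - diff i.+1 (g j)) (fun h => vec_comb_indep indep (f := h))).
  exact: vecS.
suff -> : comb us (fun j => f j - diff i.+1 (g j)) = w by rewrite -vec_lc.
rewrite combB -mxmap_comb fE vE mxmapD resolution_complex add0r -yE.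
by rewrite addrAC subrr add0r.
Qed.

End Independent.

(** Filtering [A / J ^ n] by powers, with graded pieces that are free over
    [A / J]. *)
Lemma tor_zero_mons xs n i :
  (forall k (f : nat -> A^o), comb (mons xs k) f = 0 ->
     forall j, (j < size (mons xs k))%N -> gen A^o xs (f j)) ->
  (forall i, tor_zero (gen A^o xs) i) -> tor_zero (gen A^o (mons xs n)) i.
Proof.
move=> quasi torJ; elim: n => [|n IH].
  by move=> u _; apply: addmr; rewrite lc_mons0 vec_top.
rewrite /tor_zero gen_monsS => u /(rcycles_decomp (K := gen A^o xs) (fun _ p => p) (quasi n) IH).
move=> [b [z [Bb Zz ->]]]; apply: smD; first exact: addml.
by apply: lc_rboundaries; apply: lcS Zz; exact: torJ.
Qed.

End TorPowers.

Lemma expid1 (A : comNzRingType) (I : ideal A) : expid I 1 = I.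
Proof.
apply: submodule_eqE; split=> [|a Ia].
  by apply: mulmod_min => a v Ia _; exact: ideal_scaler.
rewrite -[a]mulr1 -[a * 1]/((a : A) *: (1 : A^o)).
exact: mulmod_mem.
Qed.

Theorem proposition6p2 (A : comNzRingType) (m : ideal A) (d : nat)
    (M : lmodType A) (I : ideal A) (r : nat)
    (noethA : noetherian A)
    (localA : local_ring m)
    (dimA : krull_dim A d)
    (d_ge1 : (1 <= d)%N)
    (cmA : cohen_macaulay m A^o)
    (infinite_residue : infinite_set [set: quot m])
    (fgM : finitely_generated [set: M])
    (mcmM : maximal_cohen_macaulay m M)
    (primaryI : primary_to m I)
    (redI : reduction_number I r)
    (r_le1 : (r <= 1)%N) :
  forall (i n : nat), (1 <= i)%N ->
    exists l : nat,
      has_length (Tor i M (quot I)) l /\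
      has_length (Tor i M (quot (expid I n.+1))) (l * 'C(n + d - 1, d - 1)).
Proof.
have [[J [minJ [redr _]]] _] := redI.
have redJ : reduces_from I J 1 by move=> k k1; apply: redr; exact: leq_trans k1.
have [xs [xsd JE regA regM]] := minimal_reduction_regular noethA localA
  infinite_residue dimA cmA fgM mcmM primaryI minJ redJ.
have JI : gen A^o xs `<=` I by rewrite -JE; have [[]] := minJ.
have resF := resolutionP noethA fgM.
have quasi k f := @quasi_regular A xs k f regA.
have torJ i : tor_zero (resolution M) (gen A^o xs) i by exact: (tor_zero_gen resF).
move=> [//|i] n _.
have [c bI] : exists c, bounded_length topmod I c.
  apply: (finite_colength noethA localA) => a ma.
  by have [_ [_ Irad]] := primaryI; exact: Irad.
have [||l len] := @ilength_exists _ _ (rcycles (resolution M) I i)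
  (rboundaries (resolution M) I i.+1) (fc_rank (resolution M) i.+1 * c).
- exact: rboundaries_sub (resolution_complex resF) _.
- apply: bounded_lengthS (vec_bounded bI) => // u; exact: addmr.
exists l; split; first exact: homology_length (resolution_complex resF) _ _ len.
have -> : expid I n.+1 = lc (mons xs n) I.
  by rewrite -addn1 (expid_reduction redJ JE) // expid1.
have -> : (l * 'C(n + d - 1, d - 1) = size (mons xs n) * l)%N.
  rewrite mulnC; congr (_ * _)%N; case: xs xsd {JE regA regM JI quasi torJ} => [|x xs] xsd.
    by rewrite -xsd in d_ge1.
  rewrite size_mons_cons -xsd /= subn1 subn1 addnS /=.
  by rewrite -bin_sub ?leq_addl // addnK.
apply: (homology_length (resolution_complex resF)).
apply: (ilength_rcycles resF JI (quasi n)) len; exact: (tor_zero_mons resF).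
Qed.
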